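(* Let $C=\{C_0,\dots,C_d\}$ be a centered colorful configuration in $\mathbb{R}^d$ in relative general position, with $|C_i|\ge 2$ for all $0\le i\le d$. Then \[ \operatorname{csd}(C)\ \le\ 1+\prod_{i=0}^d\bigl(|C_i|-1\bigr). \]
   Context: A colorful configuration in $\mathbb{R}^d$ is a collection $C=\{C_0,\dots,C_d\}$ of finite sets (color classes) of points in $\mathbb{R}^d$. It is centered if $0$ lies in the relative interior of $\operatorname{conv}(C_i)$ for every $0\le i\le d$. A colorful simplex is a subset $S\subseteq C_0\cup\cdots\cup C_d$ with $|S\cap C_i|\le 1$ for all $i$. A colorful simplex $S$ is hitting if $\dim S=|S|-1=d$ (i.e. $S$ consists of $d+1$ affinely independent points) and $0\in\operatorname{conv}(S)$. The colorful simplicial depth $\operatorname{csd}(C)$ is the number of hitting colorful simplices of $C$. The configuration $C$ is in relative general position if no colorful simplex $S$ of $C$ of dimension $d-1$ contains the origin in its convex hull. *)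

(* Defs.v *)
From HB Require Import structures.
From mathcomp Require Import all_boot all_order all_algebra finmap.
From mathcomp Require Import all_classical all_reals all_analysis.
Import Order.TTheory GRing.Theory Num.Theory.
Import numFieldNormedType.Exports.

Set Implicit Arguments.
Unset Strict Implicit.
Unset Printing Implicit Defensive.

Local Open Scope classical_set_scope.
Local Open Scope ring_scope.

Section ConvexGeometry.
Context {R : realType} {d : nat}.
Implicit Types (A : set 'rV[R]_d) (S : {fset 'rV[R]_d}).

Definition convex_hull A : set 'rV[R]_d := smallest (@convex_set R 'rV[R]_d) A.

Definition affine_set A : Prop :=
  forall (x y : 'rV[R]_d) (t : R), A x -> A y -> A (t *: x + (1 - t) *: y).

Definition affine_hull A : set 'rV[R]_d := smallest affine_set A.

(* Interior of A in the topology that A inherits from its affine hull. *)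
Definition relative_interior A : set 'rV[R]_d :=
  [set x | A x /\ \forall y \near within (affine_hull A) (nbhs x), A y].

(* Dimension of the affine hull of S, i.e. of its direction space, which is
   spanned by the differences of points of S; it is -1 for the empty set. *)
Definition affine_dim S : int :=
  if S == fset0 then -1
  else (\dim <<[seq x - y | x <- enum_fset S, y <- enum_fset S]>>%VS)%:Z.

End ConvexGeometry.

Section ColorfulConfigurations.
Context {R : realType} {d : nat}.

(* C i is the i-th color class; the classes need not be disjoint. *)
Implicit Types (C : 'I_d.+1 -> {fset 'rV[R]_d}) (S : {fset 'rV[R]_d}).

Definition points C : {fset 'rV[R]_d} := (\bigcup_(i in 'I_d.+1) C i)%fset.

Definition centered C : Prop :=
  forall i, relative_interior (convex_hull [set` C i]) 0.

Definition colorful_simplex C S : Prop :=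
  (S `<=` points C)%fset /\ forall i, (#|` (S `&` C i)%fset| <= 1)%N.

Definition hitting C S : Prop :=
  [/\ colorful_simplex C S,
      affine_dim S = #|` S|%:Z - 1,
      #|` S|%:Z - 1 = d%:Z
    & convex_hull [set` S] 0].

Definition csd C : nat :=
  #|` [fset S in fpowerset (points C) | `[< hitting C S >]]%fset|.

(* "Of dimension d - 1" refers to the affine hull of S, so that affinely
   dependent colorful simplices are covered as well. *)
Definition relative_general_position C : Prop :=
  forall S, colorful_simplex C S -> affine_dim S = d%:Z - 1 ->
    ~ convex_hull [set` S] 0.

End ColorfulConfigurations.

(* Main.v *)
(* Weights [mu > 0] with [sum mu x = 0] on each class exist because the classes are
   centered, and scaling points does not affect which simplices are hit; so assume
   that each class sums to 0.  A small perturbation keeping these sums makes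
   all rainbow tuples generic and destroys no hitting simplex.

   Let [B] be the space of functions on rainbow tuples whose alternating sum over
   each octahedron [{a_0,b_0} * ... * {a_d,b_d}] vanishes; its codimension is
   [prod (|C_i| - 1)].  The bound follows from rigidity: a function of [B] which is
   supported on hitting tuples and vanishes at one of them is 0.

   Fix a color [V], and let [f_v] be the slice of such a function at [v] in [V]; it is
   supported on the rainbow simplices [T] of the other colors with [-v] in [cone T].
   The point [v] can be moved through space: at each wall crossed, a suitable
   octahedron in a halfspace, which exists because the classes are centered,
   shows that [f_v] is constant on the near side of the star of the wall, so a
   coboundary pushes its support to the far side.  Moving [v] to [-v] produces a
   function supported on the simplices met by the line through [v], which belongs to
   the same problem in the quotient by [v], and induction applies. *)
Require Import Defs.
From mathcomp Require Import all_boot all_order all_algebra ring lra.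
Import Order.TTheory GRing.Theory Num.Theory.

Set Implicit Arguments.
Unset Strict Implicit.
Unset Printing Implicit Defensive.

Local Open Scope ring_scope.

(** * Polynomials at small parameters, generic points, and sweeps across critical values *)

Section SmallParameter.
Variable R : realFieldType.

Lemma poly_bounded (p : {poly R}) :
  exists2 M, 0 < M & forall e, 0 < e < 1 -> `|p.[e]| <= M.
Proof.
elim/poly_ind: p => [|p c [M M0 pM]]; first by exists 1 => // e _; rewrite horner0 normr0.
exists (M + `|c|); first by rewrite ltr_pwDl.
move=> e /andP[e0 e1]; rewrite hornerMXaddC (le_trans (ler_normD _ _)) // lerD2r.
rewrite normrM (gtr0_norm e0); apply: (@le_trans _ _ (`|p.[e]| * 1)).
  by rewrite ler_wpM2l // ltW.
by rewrite mulr1 pM // e0.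
Qed.

(** Factors ['X] are divided out until the constant term is nonzero; it then dominates the rest,
    which is [e] times a bounded quantity. *)
Lemma small_poly (q : {poly R}) : q != 0 ->
  exists2 de, 0 < de & forall e, 0 < e < de ->
    q.[e] != 0 /\ (0 < q.[0] -> 0 < q.[e]).
Proof.
elim/poly_ind: q => [|p c IH]; first by rewrite eqxx.
rewrite hornerMXaddC mulr0 add0r; case: (eqVneq c 0) => [->|c0 _].
  rewrite addr0 mulf_eq0 polyX_eq0 orbF => /IH[de de0 H]; exists de => // e ede.
  rewrite ltxx hornerMX; split=> //; rewrite mulf_neq0 ?(H e ede).1 //.
  by case/andP: ede => /gt_eqF ->.
have [M M0 pM] := poly_bounded p.
exists (Num.min 1 (`|c| / M)); first by rewrite lt_min ltr01 divr_gt0 // normr_gt0.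
move=> e /andP[e0]; rewrite lt_min => /andP[e1]; rewrite ltr_pdivlMr // => ec.
rewrite hornerMXaddC; have : `|p.[e] * e| < `|c|.
  rewrite normrM (gtr0_norm e0); apply: le_lt_trans ec.
  by rewrite mulrC ler_wpM2l ?pM ?e0 // ltW.
move=> H; split; last first.
  by move=> cp; move: H; rewrite (gtr0_norm cp) ltr_norml => /andP[H _]; lra.
by apply: contraTneq H => /eqP; rewrite addr_eq0 => /eqP ->; rewrite normrN ltxx.
Qed.

Lemma small_polys (qs : seq {poly R}) : 0 \notin qs ->
  exists2 e, 0 < e & forall q, q \in qs -> q.[e] != 0 /\ (0 < q.[0] -> 0 < q.[e]).
Proof.
move=> qs0; suff [de de0 H] : exists2 de, 0 < de & forall e, 0 < e < de ->
    forall q, q \in qs -> q.[e] != 0 /\ (0 < q.[0] -> 0 < q.[e]).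
  by exists (de / 2); [lra | apply: H; lra].
elim: qs qs0 => [|q qs IH]; first by exists 1.
rewrite inE negb_or => /andP[q0 /IH[de1 de10 H1]].
have [|de2 de20 H2] := @small_poly q; first by rewrite eq_sym.
exists (Num.min de1 de2); first by rewrite lt_min de10.
move=> e; rewrite lt_min => /and3P[e0 e1 e2] p; rewrite inE => /orP[/eqP->|].
  by apply: H2; rewrite e0.
by apply: H1; rewrite e0.
Qed.

(** The point leaves [z] along the moment curve [(e, e^2, ..., e^d)]. Along it the form [u] becomes
    a polynomial in [e] whose coefficients include all entries of [u], hence a nonzero
    polynomial. *)
Lemma generic_near d (us : seq 'cV[R]_d) (z : 'rV[R]_d) : 0 \notin us ->
  exists y : 'rV[R]_d, forall u, u \in us ->
    (y *m u) 0 0 != 0 /\ (0 < (z *m u) 0 0 -> 0 < (y *m u) 0 0).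
Proof.
move=> us0.
pose q (u : 'cV[R]_d) : {poly R} := ((z *m u) 0 0)%:P +
  (\poly_(i < d) (if insub i is Some j then u j 0 else 0)) * 'X.
have [|e e0 H] := @small_polys (map q us).
  apply: contra us0 => /mapP[u uus q0].
  suff -> : 0 = u by [].
  apply/colP => j; rewrite mxE.
  have := congr1 (fun p : {poly R} => p`_j.+1) q0.
  by rewrite coef0 coefD coefC coefMX /= coef_poly ltn_ord valK add0r.
exists (z + \row_j e ^+ j.+1) => u uus; have := H (q u) (map_f q uus).
rewrite mulmxDl mxE /q !hornerD !hornerC !hornerMX mulr0 addr0.
suff -> : ((\row_j e ^+ j.+1) *m u) 0 0 =
   (\poly_(i < d) (if insub i is Some j then u j 0 else 0)).[e] * e by [].
rewrite mxE horner_poly mulr_suml; apply: eq_bigr => j _.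
by rewrite mxE valK exprS; ring.
Qed.

Lemma interval_avoid (s : seq R) a b : a < b ->
  exists m, [/\ a < m, m < b & m \notin s].
Proof.
elim: s a b => [|r s IH] a b ab; first by exists ((a + b) / 2); split=> //; lra.
case: (ltrP a r) => ar; last first.
  have [m [am mb ms]] := IH a b ab; exists m; split=> //.
  by rewrite inE negb_or ms andbT; apply: contraTneq am => ->; rewrite -leNgt.
have [|m [am]] := IH a (Num.min r b); first by rewrite lt_min ar.
rewrite lt_min => /andP[mr mb] ms; exists m; split=> //.
by rewrite inE negb_or ms lt_eqF.
Qed.

(** Induction on the number of critical values between [a] and [b]: two distinct ones are separated
    by a noncritical [m], and both halves contain fewer. *)
Lemma sweep_ind (P : R -> Prop) (cr : seq R) :
  (forall a c b, a < c < b -> a \notin cr -> b \notin cr ->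
     (forall r, r \in cr -> a < r < b -> r = c) -> P a -> P b) ->
  forall a b, a < b -> a \notin cr -> b \notin cr -> P a -> P b.
Proof.
move=> step a b; have [n] := ubnP (count (fun r => a < r < b) cr).
elim: n a b => // n IH a b cn ab acr bcr Pa.
case: (boolP (has (fun r => a < r < b) cr)) => [/hasP[c ccr acb]|/hasPn no]; last first.
  apply: (step a ((a + b) / 2) b) => // [|r /no/negbTE ->//]; lra.
case: (boolP (has (fun r => (a < r < b) && (r != c)) cr)); last first.
  move=> /hasPn no; apply: (step a c b) => // r /no; rewrite negb_and negbK.
  by move=> + H; rewrite H => /eqP.
move=> /hasP[c' c'cr /andP[ac'b cc']].
wlog: c c' ccr c'cr acb ac'b cc' / c < c'.
  move=> W; case: (ltgtP c c') => [|c'c|e]; first exact: W.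
    by apply: (W c' c) => //; rewrite eq_sym.
  by rewrite e eqxx in cc'.
move=> lcc'; have [m [cm mc' mcr]] := interval_avoid cr lcc'.
have [am mb] : a < m /\ m < b by lra.
pose I u v := fun r : R => u < r < v.
have U : (count (I a m) cr + count (I m b) cr <= count (I a b) cr)%N.
  rewrite -count_predUI [X in (_ + X)%N](eq_count (a2 := pred0)).
    rewrite count_pred0 addn0; apply: sub_count => r; rewrite /I /=; lra.
  by move=> r; rewrite /I /=; apply/negbTE/negP; lra.
have c1 : (0 < count (I a m) cr)%N.
  by rewrite -has_count; apply/hasP; exists c => //; rewrite /I; lra.
have c2 : (0 < count (I m b) cr)%N.
  by rewrite -has_count; apply/hasP; exists c' => //; rewrite /I; lra.
have cn' : (count (I a b) cr <= n)%N by [].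
apply: (IH m b) => //; last apply: (IH a m) => //.
  by apply: leq_trans cn'; apply: leq_trans U; rewrite -add1n leq_add2r.
by apply: leq_trans cn'; apply: leq_trans U; rewrite -addn1 leq_add2l.
Qed.

End SmallParameter.

(** * Octahedral sums of functions on tuples *)

Section Octahedra.
Variables (R : comNzRingType) (I X : finType).
Implicit Types (J K S : {set I}) (a b t : {ffun I -> X}) (f g : {ffun I -> X} -> R).

Definition upd t i x : {ffun I -> X} := [ffun j => if j == i then x else t j].
Definition mix S a b : {ffun I -> X} := [ffun j => if j \in S then b j else a j].
(* The signed sum of [f] over the vertices of an octahedron (a cross-polytope):
   in the directions [j] in [J] both [a j] and [b j] occur, elsewhere [a j].
   Functions killed by all these sums are the coboundaries of the join. *)
Definition osum J f a b : R := \sum_(S in powerset J) (-1) ^+ #|S| * f (mix S a b).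

Lemma updE t i x j : upd t i x j = if j == i then x else t j.
Proof. by rewrite ffunE. Qed.

Lemma upd_id t i x : upd t i x i = x.
Proof. by rewrite updE eqxx. Qed.

Lemma updK t i : upd t i (t i) = t.
Proof. by apply/ffunP=> j; rewrite updE; case: eqP => // ->. Qed.

Lemma upd_upd t i x y : upd (upd t i x) i y = upd t i y.
Proof. by apply/ffunP=> j; rewrite !updE; case: eqP. Qed.

Lemma upd_family (A : I -> {set X}) t i x :
  t \in family A -> x \in A i -> upd t i x \in family A.
Proof.
move=> /familyP tA xA; apply/familyP=> j; rewrite updE.
by case: eqP => [->|].
Qed.

Lemma mix_family (A : I -> {set X}) S a b :
  a \in family A -> b \in family A -> mix S a b \in family A.
Proof.
move=> /familyP aA /familyP bA; apply/familyP=> j; rewrite ffunE.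
by case: ifP.
Qed.

Lemma osum0 f a b : osum set0 f a b = f a.
Proof.
rewrite /osum powerset0 big_set1 cards0 mul1r.
by congr f; apply/ffunP=> j; rewrite ffunE inE.
Qed.

Lemma osumB J f g a b :
  osum J (fun t => f t - g t) a b = osum J f a b - osum J g a b.
Proof. by rewrite /osum -sumrB; apply: eq_bigr => S _; rewrite mulrBr. Qed.

Lemma osum_eq0 J f a b :
  (forall S, S \subset J -> f (mix S a b) = 0) -> osum J f a b = 0.
Proof. by move=> f0; apply: big1 => S; rewrite inE => /f0 ->; rewrite mulr0. Qed.

Lemma osum_split J f a b j : j \in J ->
  osum J f a b = osum (J :\ j) f a b - osum (J :\ j) f (upd a j (b j)) b.
Proof.
move=> jJ; rewrite {1}/osum (bigID (fun S : {set I} => j \in S)) /= addrC.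
congr (_ + _).
  by apply: eq_bigl => S; rewrite !inE subsetD1.
rewrite -sumrN (reindex_onto (fun S : {set I} => j |: S) (fun S => S :\ j)) /=; last first.
  by move=> S /andP[_ jS]; rewrite setD1K.
apply: eq_big => S.
  rewrite !inE subUset sub1set jJ eqxx /= andbT subsetD1.
  congr (_ && _); apply/eqP/idP => [<-|jS]; first by rewrite !inE eqxx.
  by rewrite setU1K.
move=> /andP[/andP[_ _] /eqP SE].
have jS : j \notin S by rewrite -SE !inE eqxx.
rewrite cardsU1 jS exprS mulN1r mulNr; congr (- (_ * f _)).
apply/ffunP=> i; rewrite !ffunE !inE; case: eqP => [->|] //=.
by rewrite (negPf jS).
Qed.

(** Vertices with [a j] and with [b j] cancel in pairs. This is the source of the coboundaries
    subtracted at walls. *)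
Lemma osum_indep (A : I -> {set X}) J f a b j : j \in J ->
  (forall t x, t \in family A -> x \in A j -> f (upd t j x) = f t) ->
  a \in family A -> b \in family A -> osum J f a b = 0.
Proof.
move=> jJ fj aA bA; rewrite (osum_split _ _ _ jJ); apply/eqP; rewrite subr_eq0.
apply/eqP; apply: eq_bigr => S; rewrite inE => /subsetD1P[_ jS]; congr (_ * _).
have bj : b j \in A j by exact: (familyP bA).
rewrite -[LHS](fj _ (b j)) ?mix_family //; congr f; apply/ffunP=> i; rewrite !ffunE.
by case: eqP => // ->; rewrite (negPf jS).
Qed.

Lemma osum_sub J K f a b : K \subset J ->
  (forall S, S \subset J -> ~~ (S \subset K) -> f (mix S a b) = 0) ->
  osum J f a b = osum K f a b.
Proof.
move=> KJ f0; rewrite /osum (bigID (fun S : {set I} => S \subset K)) /=.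
rewrite [X in _ + X]big1 ?addr0 => [|S /andP[]]; last first.
  by rewrite inE => SJ SK; rewrite f0 ?mulr0.
apply: eq_bigl => S; rewrite !inE andb_idl // => SK; exact: subset_trans KJ.
Qed.

Lemma osum_updr J f a b j y : osum (J :\ j) f a (upd b j y) = osum (J :\ j) f a b.
Proof.
apply: eq_bigr => S; rewrite inE => /subsetD1P[_ jS].
congr (_ * f _); apply/ffunP => i; rewrite !ffunE.
by case: (i =P j) => // ->; rewrite (negPf jS).
Qed.

Lemma osum_same J f a b j : j \in J -> a j = b j -> osum J f a b = 0.
Proof. by move=> jJ ab; rewrite (osum_split _ _ _ jJ) -ab updK subrr. Qed.

(* e_a - e_b = (e_o - e_b) - (e_o - e_a) in each coordinate, so octahedra with
   apex [o] generate all octahedra. *)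
Lemma osum_base (A : I -> {set X}) J f o : o \in family A ->
  (forall b, b \in family A -> (forall j, j \in J -> b j != o j) ->
     osum J f o b = 0) -> 
  (forall j, j \notin J -> A j = [set o j]) ->
  forall a b, a \in family A -> b \in family A -> osum J f a b = 0.
Proof.
move=> oA H AJ a b.
have [n] := ubnP #|[set j | a j != o j]|.
elim: n a b => // n IH a b leqn aA bA.
case: (set_0Vmem [set j | a j != o j]) => [a0|[j]].
  have -> : a = o.
    apply/ffunP=> j; apply/eqP; move/setP/(_ j): a0; rewrite !inE.
    by move/negbFE.
  case: (boolP [forall j in J, b j != o j]) => [/forall_inP bo|]; first exact: H.
  rewrite negb_forall_in => /exists_inP[j jJ /negPn/eqP bo].
  by apply: (osum_same _ jJ); rewrite bo.
rewrite inE => ajo.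
have jJ : j \in J.
  apply: contraNT ajo => jJ; move/familyP/(_ j): aA.
  by rewrite AJ // inE.
have step b' : b' \in family A -> osum J f (upd a j (o j)) b' = 0.
  move=> b'A; apply: IH => //; last by apply: upd_family => //; exact: (familyP oA).
  rewrite -ltnS; apply: leq_trans leqn; rewrite ltnS; apply: proper_card.
  apply/properP; split; last by exists j; rewrite !inE ?updE ?eqxx // ajo.
  apply/subsetP=> i; rewrite !inE updE; by case: (i =P j) => [->|//]; rewrite eqxx.
have ajA : a j \in A j by exact: (familyP aA).
have e1 := step _ bA.
have e2 := step _ (upd_family bA ajA).
move: e1 e2; rewrite !(osum_split f _ _ jJ) !upd_upd upd_id updK.
move=> e1 e2.
rewrite !osum_updr in e2.
move/eqP: e1; rewrite subr_eq0 => /eqP e1; move/eqP: e2; rewrite subr_eq0 => /eqP e2.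
by rewrite -e1 e2 subrr.
Qed.

End Octahedra.

(** * Coordinates in a basis and the exchange of one basis vector *)

Section Coordinates.
Variables (R : realFieldType) (d : nat).
Implicit Types (m : 'I_d -> 'rV[R]_d) (x y z : 'rV[R]_d).

Definition rows_mx m : 'M[R]_d := \matrix_j m j.
Definition coord m j z : R := (z *m invmx (rows_mx m)) 0 j.

Lemma coord_sum m z : rows_mx m \in unitmx -> z = \sum_j coord m j z *: m j.
Proof.
move=> mU; rewrite -{1}[z](mulmxKV mU) mulmx_sum_row.
by apply: eq_bigr => j _; rewrite rowK.
Qed.

Lemma coord_uniq m l j : rows_mx m \in unitmx ->
  coord m j (\sum_k l k *: m k) = l j.
Proof.
move=> mU; have -> : \sum_k l k *: m k = (\row_k l k) *m rows_mx m.
  by rewrite mulmx_sum_row; apply: eq_bigr => k _; rewrite rowK mxE.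
by rewrite /coord mulmxK // mxE.
Qed.

Lemma coordD m j x y : coord m j (x + y) = coord m j x + coord m j y.
Proof. by rewrite /coord mulmxDl mxE. Qed.

Lemma coordZ m j a x : coord m j (a *: x) = a * coord m j x.
Proof. by rewrite /coord -scalemxAl mxE. Qed.

Lemma coord0 m j : coord m j 0 = 0.
Proof. by rewrite /coord mul0mx mxE. Qed.

Lemma coordN m j x : coord m j (- x) = - coord m j x.
Proof. by rewrite -scaleN1r coordZ mulN1r. Qed.

Lemma coord_lin m j (I : finType) (l : I -> R) (p : I -> 'rV[R]_d) :
  coord m j (\sum_k l k *: p k) = \sum_k l k * coord m j (p k).
Proof.
rewrite /coord mulmx_suml summxE; apply: eq_bigr => k _.
by rewrite -scalemxAl mxE.
Qed.

Lemma coordE m j z : coord m j z = (z *m col j (invmx (rows_mx m))) 0 0.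
Proof. by rewrite /coord !mxE; apply: eq_bigr => k _; rewrite !mxE. Qed.

Lemma coord_self m j i : rows_mx m \in unitmx -> coord m j (m i) = (i == j)%:R.
Proof.
move=> mU; have -> : m i = \sum_k (i == k)%:R *: m k.
  rewrite (bigD1 i) //= eqxx scale1r big1 ?addr0 // => k ki.
  by rewrite eq_sym (negPf ki) scale0r.
by rewrite coord_uniq.
Qed.

(** Expand [x] in the basis [m] and read off the [m']-coordinates term by term; only [m i] is not
    itself a vector of [m']. *)
Lemma coord_upd m m' i j x : rows_mx m \in unitmx -> rows_mx m' \in unitmx ->
  (forall k, k != i -> m' k = m k) ->
  coord m' j x = (j != i)%:R * coord m j x + coord m i x * coord m' j (m i).
Proof.
move=> mU m'U mm'; rewrite {1}[x](coord_sum x mU) coord_lin.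
rewrite (bigD1 i) //= addrC; congr (_ + _).
case: (eqVneq j i) => [->|ji] /=.
  rewrite mul0r; apply: big1 => k ki.
  by rewrite -(mm' _ ki) coord_self // (negPf ki) mulr0.
rewrite mul1r (bigD1 j) //= -(mm' _ ji) coord_self // eqxx mulr1 big1 ?addr0 //.
by move=> k /andP[ki kj]; rewrite -(mm' _ ki) coord_self // (negPf kj) mulr0.
Qed.

(** The exchange formula applied to [m' i] itself. It serves to compare signs: the two exchange
    coefficients have the same one. *)
Lemma coord_swap m m' i : rows_mx m \in unitmx -> rows_mx m' \in unitmx ->
  (forall k, k != i -> m' k = m k) -> coord m i (m' i) * coord m' i (m i) = 1.
Proof.
move=> mU m'U mm'; rewrite -[RHS](_ : coord m' i (m' i) = 1).
  by rewrite (coord_upd i (m' i) mU m'U mm') eqxx /= mul0r add0r.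
by rewrite coord_self // eqxx.
Qed.

End Coordinates.

(** * Hitting simplices and cocycles with a moving target *)

Section Sweep.
Variables (R : realFieldType) (d : nat) (X : finType).
Implicit Types (A : 'I_d -> {set X}) (J : {set 'I_d}) (x w : 'rV[R]_d).
Implicit Types (e : X) (t a b s : {ffun 'I_d -> X}) (f : {ffun 'I_d -> X} -> R).

(** Dual form of centeredness: for nonempty [B], no hyperplane through 0 properly supports the
    points [p x], so 0 is in the relative interior of their convex hull. *)
Definition balanced (p : X -> 'rV[R]_d) (B : {set X}) :=
  forall u : 'cV[R]_d, (exists2 x, x \in B & (p x *m u) 0 0 < 0) ->
  exists2 y, y \in B & 0 < (p y *m u) 0 0.

Lemma balancedN p B (u : 'cV[R]_d) : balanced p B ->
  (exists2 x, x \in B & 0 < (p x *m u) 0 0) ->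
  exists2 y, y \in B & (p y *m u) 0 0 < 0.
Proof.
move=> bal [x xB ux]; have [|y yB] := bal (- u).
  by exists x => //; rewrite mulmxN mxE oppr_lt0.
by rewrite mulmxN mxE oppr_gt0; exists y.
Qed.

Lemma balanced_pos p B (u : 'cV[R]_d) : balanced p B ->
  (exists2 x, x \in B & (p x *m u) 0 0 != 0) ->
  exists2 y, y \in B & 0 < (p y *m u) 0 0.
Proof.
move=> bal [x xB]; rewrite neq_lt => /orP[ux|ux]; last by exists x.
by apply: bal; exists x.
Qed.

Variable pos : 'I_d -> X -> 'rV[R]_d.

Definition at_ t : 'I_d -> 'rV[R]_d := fun j => pos j (t j).

(* [- x] lies in the cone of [t] (relatively to the directions outside [J]). *)
Definition hits J x t := [forall j in J, coord (at_ t) j x < 0].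

Definition indep A := forall t, t \in family A -> rows_mx (at_ t) \in unitmx.

Definition cocyc A J f :=
  forall a b, a \in family A -> b \in family A -> osum J f a b = 0.

Definition generic A J x :=
  forall t j, t \in family A -> j \in J -> coord (at_ t) j x != 0.

Definition supported A J x f :=
  forall t, t \in family A -> f t != 0 -> hits J x t.

(** The induction is on [J]: a direction leaves [J] when its vertex is frozen, and ignoring its
    coordinate means working modulo the span of that vertex. *)
Definition vanishing J := forall A x f,
  indep A -> (forall j, j \in J -> balanced (pos j) (A j)) ->
  generic A J x -> supported A J x f -> cocyc A J f ->
  forall t, t \in family A -> f t = 0.

(** A slice of a function on all colors need not be a cocycle, but it is killed by the octahedra in
    a closed halfspace bounded by a facet hyperplane (see [halfspace_of_cocyc]), and this is enough
    to cross walls. *)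
Definition halfspace_cocyc A J f := forall t i a b,
  t \in family A -> i \in J -> a \in family A -> b \in family A ->
  (forall j, j \in J -> 0 <= coord (at_ t) i (pos j (a j))) ->
  (forall j, j \in J -> 0 <= coord (at_ t) i (pos j (b j))) ->
  (forall j, j \notin J -> coord (at_ t) i (pos j (a j)) = 0) ->
  osum J f a b = 0.

(** * Wall crossing: the target passes from [x] through [w] to [x'] *)

Section Crossing.
Variables (A : 'I_d -> {set X}) (J : {set 'I_d}) (x x' w : 'rV[R]_d).
Hypothesis indA : indep A.
Hypothesis balA : forall j, j \in J -> balanced (pos j) (A j).
Hypothesis genx : generic A J x.
Hypothesis near_w : forall t j, t \in family A -> j \in J ->
  coord (at_ t) j w != 0 -> Num.sg (coord (at_ t) j x) = Num.sg (coord (at_ t) j w)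
     /\ Num.sg (coord (at_ t) j x') = Num.sg (coord (at_ t) j w).
Hypothesis flip : forall t j, t \in family A -> j \in J ->
  coord (at_ t) j w = 0 -> coord (at_ t) j x * coord (at_ t) j x' < 0.
(** Many tuples may meet a wall at [w] simultaneously, but each of them in one coordinate only. *)
Hypothesis one_wall : forall t i j, t \in family A -> i \in J -> j \in J ->
  coord (at_ t) i w = 0 -> coord (at_ t) j w = 0 -> i = j.
Hypothesis IH : forall J0 : {set 'I_d}, J0 \proper J -> vanishing J0.

Lemma at_upd t i e k : k != i -> at_ (upd t i e) k = at_ t k.
Proof. by move=> ki; rewrite /at_ updE (negPf ki). Qed.

(** Since [w] lies in the hyperplane spanned by the other vertices, its expansion does not see the
    vertex [i]. *)
Lemma coord_upd_wall t i e j : t \in family A -> e \in A i ->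
  coord (at_ t) i w = 0 -> coord (at_ (upd t i e)) j w = coord (at_ t) j w.
Proof.
move=> tA zA tiw; rewrite (coord_upd j w (indA tA) (indA (upd_family tA zA)) (at_upd t e)).
by rewrite tiw mul0r addr0; case: eqP => [->|]; rewrite ?tiw ?mulr0 // mul1r.
Qed.

(* Complete [t] and [upd t i e] to an octahedron on the positive side of the
   wall, with the other antipodes strictly positive whenever their class is not
   contained in the wall.  No vertex of it involving a strictly positive
   antipode can hit [x], so its vanishing compares [f] at [t] and at [upd t i e], up
   to the vertices in classes contained in the wall; those are dealt with by
   induction. *)
Lemma star_const f t i e : supported A J x f -> halfspace_cocyc A J f ->
  t \in family A -> i \in J -> e \in A i -> coord (at_ t) i w = 0 ->
  hits J x t -> hits J x (upd t i e) -> f t = f (upd t i e).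
Proof.
move=> supp Hf tA iJ zA tiw ht ht'.
set u := coord (at_ t) i.
have t'A := upd_family tA zA.
(* The coordinate [i] of [x] is negative in both bases, so the exchange coefficients are positive:
   [e] is on the same side of the wall as [t i]. *)
have uz : 0 < u (pos i e).
  have := coord_upd i x (indA tA) (indA t'A) (at_upd t e).
  have := coord_swap (indA tA) (indA t'A) (at_upd t e).
  rewrite eqxx /= mul0r add0r [X in coord (at_ t) i X]/at_ upd_id -/u => e1 e2.
  move/forall_inP/(_ i iJ): ht' ; rewrite e2 nmulr_rlt0; last exact: (forall_inP ht).
  by move=> q; rewrite -(pmulr_lgt0 (u _) q) e1 ltr01.
pose J0 := [set j in J | (j != i) && [forall y in A j, u (pos j y) == 0]].
have J0J : J0 \subset J by apply/subsetP => j; rewrite inE => /andP[].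
have iJ0 : i \notin J0 by rewrite inE eqxx andbF.
have uJ0 j y : j \in J0 -> y \in A j -> u (pos j y) = 0.
  by rewrite inE => /and3P[_ _ /forall_inP H] /H /eqP.
have ut j : u (pos j (t j)) = (j == i)%:R by rewrite /u -/(at_ t j) coord_self ?indA.
(* The antipodes. The default [t j] can only occur for [j] in [J0] or outside [J], because balance
   provides a positive point in all other cases. *)
pose r : {ffun 'I_d -> X} := [ffun j => if j == i then e else
  odflt (t j) [pick y in A j | 0 < u (pos j y)]].
have rA : r \in family A.
  apply/familyP => j; rewrite ffunE; case: eqP => [->//|_].
  by case: pickP => [y /andP[]|_] //=; exact: (familyP tA).
have ur j : j \in J -> j \notin J0 -> 0 < u (pos j (r j)).
  move=> jJ jJ0; rewrite ffunE; case: eqP => [->//|/eqP ji].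
  case: pickP => [y /andP[]|no] //=.
  have [|y yA uy] := @balanced_pos (pos j) (A j) (col i (invmx (rows_mx (at_ t)))) (balA jJ).
    move: jJ0; rewrite inE jJ ji /= negb_forall_in => /exists_inP[y yA uy].
    by exists y => //; rewrite -coordE.
  by rewrite -coordE in uy; move: (no y); rewrite yA uy.
pose A' j := if j \in J0 then A j else [set t j].
have A'A s : s \in family A' -> s \in family A.
  move=> /familyP sA; apply/familyP => j; move: (sA j); rewrite /A'.
  by case: ifP => // _; rewrite inE => /eqP ->; exact: (familyP tA).
have A'E s j : s \in family A' -> j \notin J0 -> s j = t j.
  by move=> sA /negPf jJ0; move: (familyP sA j); rewrite /A' jJ0 inE => /eqP.
have us s j : s \in family A' -> u (pos j (s j)) = (j == i)%:R.
  move=> sA; case: (boolP (j \in J0)) => jJ0; last by rewrite A'E.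
  rewrite uJ0 ?(familyP (A'A _ sA)) //; case: eqP => // ji.
  by rewrite ji (negPf iJ0) in jJ0.
have tA' : t \in family A'.
  apply/familyP => j; rewrite /A'; case: ifP; rewrite ?inE // => _.
  exact: (familyP tA).
apply/eqP; rewrite -subr_eq0; apply/eqP.
have J0pJ : J0 \proper J by apply/properP; split => //; exists i.
apply: (IH J0pJ (A := A') (x := x) (f := fun s => f s - f (upd s i e))) => //.
- by move=> s /A'A /indA.
- by move=> j jJ0; rewrite /A' jJ0; apply: balA; exact: (subsetP J0J).
- by move=> s j /A'A sA jJ0; apply: genx => //; exact: (subsetP J0J).
- move=> s sA' hs; have sA := A'A _ sA'.
  apply/forall_inP => j jJ0; have jJ := subsetP J0J _ jJ0.
  case: (eqVneq (f s) 0) => [fs|/(supp _ sA)/forall_inP/(_ j jJ)//].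
  have s'A := upd_family sA zA.
  (* Now [upd s i e] hits [x]. The coordinate [j] of [w] is nonzero and equal for both tuples, and
     that of [x] shares its sign, so [s] is hit in direction [j] too. *)
  move: hs; rewrite fs sub0r oppr_eq0 => /(supp _ s'A)/forall_inP/(_ j jJ).
  have siw : coord (at_ s) i w = 0.
    have := tiw; rewrite {1}[w](coord_sum w (indA sA)) coord_lin (bigD1 i) //=.
    rewrite big1 ?addr0 => [|k ki]; first by rewrite /at_ -/(at_ t) -/u us // eqxx mulr1.
    by rewrite -/(at_ t) -/u us // (negPf ki) mulr0.
  have ji : j != i by apply: contraNneq iJ0 => <-.
  have sjw : coord (at_ s) j w != 0.
    by apply: contraNneq ji => sjw; apply/eqP; apply: (one_wall sA).
  have sjw' : coord (at_ (upd s i e)) j w != 0 by rewrite coord_upd_wall.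
  rewrite -sgr_lt0 (near_w s'A jJ sjw').1 coord_upd_wall // -(near_w sA jJ sjw).1.
  by rewrite sgr_lt0.
move=> a b aA' bA'; have aA := A'A _ aA'; have bA := A'A _ bA'.
pose b' : {ffun 'I_d -> X} := mix J0 r b.
have b'A : b' \in family A by exact: mix_family.
have ub' j : j \in J -> 0 <= u (pos j (b' j)).
  move=> jJ; rewrite /b' ffunE; case: ifP => [jJ0|/negbT jJ0]; last exact/ltW/ur.
  by rewrite us // ler0n.
have : osum J f a b' = 0.
  apply: (Hf _ _ _ _ tA iJ aA b'A _ ub') => j jJ; first by rewrite -/u us // ler0n.
  by rewrite -/u us //; case: eqP => // ji; rewrite ji iJ in jJ.
have b'i : b' i = e by rewrite /b' !ffunE (negPf iJ0) eqxx.
rewrite (osum_sub (K := i |: J0)); first last.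
- move=> S SJ /subsetPn[j jS]; rewrite in_setU1 negb_or => /andP[ji jJ0].
  have sA := mix_family S aA b'A; set s := mix S a b' in sA *.
  (* If such a vertex [s] hits [x], all terms in the expansion of [u w = 0] along [s] are
     nonpositive, hence zero. Then the coordinates [i] and [j] of [w] both vanish, and [one_wall]
     gives [j = i]. *)
  apply/eqP; apply: contraNT ji => /(supp _ sA)/forall_inP hs.
  have sw k : k \in J -> coord (at_ s) k w <= 0.
    move=> kJ; case: (eqVneq (coord (at_ s) k w) 0) => [->//|kw].
    by rewrite -sgr_le0 -(near_w sA kJ kw).1 sgr_le0 ltW ?hs.
  have us0 k : k \in J -> 0 <= u (pos k (s k)).
    move=> kJ; rewrite /s ffunE; case: ifP => _; first exact: ub'.
    by rewrite us // ler0n.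
  have term k : coord (at_ s) k w * u (pos k (s k)) <= 0.
    case: (boolP (k \in J)) => kJ; first by rewrite mulr_le0_ge0 ?sw ?us0.
    rewrite /s ffunE ifN ?us //; last by apply: contra kJ; exact: (subsetP SJ).
    by case: (k =P i) => [ki|_]; rewrite ?mulr0 //; move: kJ; rewrite ki iJ.
  have sum0 : \sum_k - (coord (at_ s) k w * u (pos k (s k))) = 0.
    apply/eqP; rewrite sumrN oppr_eq0; apply/eqP.
    by rewrite -[RHS]tiw [in RHS](coord_sum w (indA sA)) coord_lin.
  have zero k : coord (at_ s) k w * u (pos k (s k)) = 0.
    apply/eqP; rewrite -oppr_eq0; apply/eqP; move: k (erefl true).
    apply: (psumr_eq0P _ sum0) => k _; by rewrite oppr_ge0.
  have jJ := subsetP SJ _ jS.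
  apply/eqP; apply: (one_wall sA) => //.
    have /eqP := zero j; rewrite mulf_eq0 => /orP[/eqP //|].
    by rewrite /s ffunE jS /b' ffunE (negPf jJ0) gt_eqF // ur.
  have /eqP := zero i; rewrite mulf_eq0 => /orP[/eqP //|].
  rewrite /s ffunE b'i; case: ifP => _; first by rewrite gt_eqF.
  by rewrite us // eqxx oner_eq0.
- by rewrite subUset sub1set iJ.
rewrite (osum_split f a b' (setU11 i J0)) setU1K // b'i => <-.
rewrite osumB; congr (_ - _); apply: eq_bigr => S; rewrite inE => SJ0.
  congr (_ * f _); apply/ffunP => j; rewrite !ffunE; case: ifP => // jS.
  by rewrite (subsetP SJ0 _ jS).
congr (_ * f _); apply/ffunP => j; rewrite !ffunE; case: (j =P i) => [->|_].
  by rewrite ifN //; apply: contra iJ0; exact: (subsetP SJ0).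
by case: ifP => // jS; rewrite (subsetP SJ0 _ jS).
Qed.

(** Modulo the directions outside [J], [- w] lies in the open cone of the facet of [t] opposite to
    [t i]; the condition therefore does not depend on [t i]. *)
Definition wall t i :=
  (coord (at_ t) i w == 0) && [forall j in J :\ i, coord (at_ t) j w < 0].

Definition kappa f t i : R :=
  if [pick e in A i | coord (at_ (upd t i e)) i x < 0] is Some e
  then f (upd t i e) else 0.

(* By [star_const], [f] takes a single value [kappa f t i] on the part of the star
   of each wall lying on the side of [x]; subtracting it on the whole star, which
   is a coboundary, moves the support to the side of [x']. *)
Definition cross f t : R :=
  f t - \sum_(i in J) (if wall t i then kappa f t i else 0).

Lemma wall_upd t i e : t \in family A -> e \in A i -> i \in J ->
  wall (upd t i e) i = wall t i.
Proof.
have dir t' e' : t' \in family A -> e' \in A i -> wall t' i -> wall (upd t' i e') i.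
  move=> tA eA /andP[/eqP tiw /forall_inP tw]; apply/andP; split.
    by rewrite coord_upd_wall // tiw.
  by apply/forall_inP => j /tw; rewrite coord_upd_wall.
move=> tA eA iJ; apply/idP/idP; last exact: dir.
move=> /(dir _ (t i) (upd_family tA eA)); rewrite upd_upd updK; apply.
exact: (familyP tA).
Qed.

Lemma kappa_upd f t i e : kappa f (upd t i e) i = kappa f t i.
Proof.
rewrite /kappa; under eq_pick => y do rewrite upd_upd.
by case: pickP => // y _; rewrite upd_upd.
Qed.

Lemma cross_wall f t i : t \in family A -> i \in J -> wall t i ->
  cross f t = f t - kappa f t i.
Proof.
move=> tA iJ wi; rewrite /cross (bigD1 i) //= wi big1 ?addr0 // => j /andP[jJ ji].
case: ifP => // wj; case/eqP: ji; apply: (one_wall tA) => //.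
  by case/andP: wj => /eqP.
by case/andP: wi => /eqP.
Qed.

Lemma wall_sg t i j : t \in family A -> wall t i -> j \in J -> j != i ->
  coord (at_ t) j x < 0 /\ coord (at_ t) j x' < 0.
Proof.
move=> tA /andP[_ /forall_inP tw] jJ ji.
have tj : coord (at_ t) j w < 0 by apply: tw; rewrite !inE ji.
have [e1 e2] := near_w tA jJ (ltr0_neq0 tj).
by split; rewrite -sgr_lt0 ?e1 ?e2 sgr_lt0.
Qed.

Lemma wall_hits t i : t \in family A -> i \in J -> wall t i ->
  hits J x t = (coord (at_ t) i x < 0) /\ hits J x' t = (coord (at_ t) i x' < 0).
Proof.
move=> tA iJ wi; split; apply/forall_inP/idP => [/(_ i iJ)//|ti j jJ].
  by case: (eqVneq j i) => [->//|/(wall_sg tA wi jJ)[]].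
by case: (eqVneq j i) => [->//|/(wall_sg tA wi jJ)[]].
Qed.

(** Balance puts a point of [A i] strictly beyond the facet hyperplane, and exchanging [t i] for it
    flips the sign by [coord_swap]. *)
Lemma wall_opposite t i : t \in family A -> i \in J ->
  exists2 e, e \in A i & coord (at_ (upd t i e)) i x * coord (at_ t) i x < 0.
Proof.
move=> tA iJ; have [|e eA ue] := balancedN (u := col i (invmx (rows_mx (at_ t)))) (balA iJ).
  exists (t i); first exact: (familyP tA).
  by rewrite -coordE -/(at_ t i) coord_self ?indA // eqxx ltr01.
exists e => //; rewrite -coordE in ue; have t'A := upd_family tA eA.
rewrite (coord_upd i x (indA tA) (indA t'A) (at_upd t e)) eqxx mul0r add0r.
rewrite mulrAC -expr2 pmulr_rlt0; last by rewrite exprn_even_gt0 //= genx.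
have := coord_swap (indA tA) (indA t'A) (at_upd t e).
rewrite [X in coord (at_ t) i X]/at_ upd_id => e1.
by rewrite -(nmulr_rgt0 _ ue) e1 ltr01.
Qed.

Section Step.
Variable f : {ffun 'I_d -> X} -> R.
Hypothesis suppf : supported A J x f.
Hypothesis halff : halfspace_cocyc A J f.

Lemma kappaE t i : t \in family A -> i \in J -> wall t i -> hits J x t ->
  kappa f t i = f t.
Proof.
move=> tA iJ wi ht; have hti := forall_inP ht _ iJ.
have tiw : coord (at_ t) i w = 0 by case/andP: wi => /eqP.
rewrite /kappa; case: pickP => [e /andP[eA ue]|]; last first.
  by move/(_ (t i)); rewrite updK (familyP tA) hti.
apply/esym/star_const => //; have t'A := upd_family tA eA.
by rewrite (wall_hits t'A iJ _).1 // wall_upd.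
Qed.

(** Without a wall nothing changes at [t]; otherwise [f t] reappears with opposite sign at a tuple
    of the star on the far side, where [f] was 0. *)
Lemma cross_neq0 t : t \in family A -> f t != 0 ->
  exists2 t', t' \in family A & cross f t' != 0.
Proof.
move=> tA ft; have ht := suppf tA ft.
case: (pickP (fun i => (i \in J) && wall t i)) => [i /andP[iJ wi]|nw]; last first.
  exists t => //; rewrite /cross big1 ?subr0 // => i iJ.
  by move: (nw i); rewrite iJ /= => ->.
have [e eA ue] := wall_opposite tA iJ; have t'A := upd_family tA eA.
exists (upd t i e) => //; rewrite (cross_wall _ t'A iJ) ?wall_upd // kappa_upd.
rewrite (kappaE tA iJ wi ht); suff -> : f (upd t i e) = 0 by rewrite sub0r oppr_eq0.
apply/eqP; apply: contraTT ue => /(suppf t'A)/forall_inP/(_ i iJ) h.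
by rewrite -leNgt ltW // nmulr_rgt0 // (forall_inP ht).
Qed.

(** On the near side of a star [f t] cancels against [kappa]. A tuple without a wall in the support
    of [f] has no coordinate vanishing at [w], so all its signs persist from [x] to [x']. *)
Lemma supported_cross : supported A J x' (cross f).
Proof.
move=> t tA; case: (pickP (fun i => (i \in J) && wall t i)) => [i /andP[iJ wi]|nw].
  rewrite (cross_wall _ tA iJ wi) (wall_hits tA iJ wi).2.
  have tiw : coord (at_ t) i w = 0 by case/andP: wi => /eqP.
  have := flip tA iJ tiw; case: (ltgtP (coord (at_ t) i x) 0) => [ti|ti|ti].
  - by rewrite kappaE ?subrr ?eqxx // (wall_hits tA iJ wi).1.
  - by rewrite pmulr_rlt0.
  - by rewrite ti mul0r ltxx.
rewrite /cross big1 ?subr0 => [ft|i iJ]; last by move: (nw i); rewrite iJ /= => ->.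
have ht := forall_inP (suppf tA ft).
have tw j : j \in J -> coord (at_ t) j w != 0 -> coord (at_ t) j w < 0.
  by move=> jJ jw; rewrite -sgr_lt0 -(near_w tA jJ jw).1 sgr_lt0 ht.
apply/forall_inP => j jJ; case: (eqVneq (coord (at_ t) j w) 0) => jw; last first.
  by rewrite -sgr_lt0 (near_w tA jJ jw).2 sgr_lt0 tw.
case/negP: (nw j); rewrite jJ /wall jw eqxx /=; apply/forall_inP => k.
rewrite !inE => /andP[kj kJ]; apply: tw => //; apply: contra kj => /eqP kw.
by rewrite (one_wall tA jJ kJ).
Qed.

(** The summand for [i] does not depend on [t i], so [osum_indep] applies to it. *)
Lemma cocyc_cross : cocyc A J (fun t => f t - cross f t).
Proof.
move=> a b aA bA.
have -> : osum J (fun t => f t - cross f t) a b =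
    \sum_(i in J) osum J (fun t => if wall t i then kappa f t i else 0) a b.
  rewrite /osum exchange_big /=; apply: eq_bigr => S _.
  by rewrite /cross opprB addrC subrK mulr_sumr.
apply: big1 => i iJ; apply: (osum_indep iJ _ aA bA) => t e tA eA.
by rewrite wall_upd // kappa_upd.
Qed.
End Step.

End Crossing.

End Sweep.

(** * Sign changes of a coordinate in linear motion *)

Section Affine.
Variable R : realFieldType.

Definition aff (u v s : R) := (1 - s) * u + s * v.

Lemma affE u v s : aff u v s = u + s * (v - u).
Proof. by rewrite /aff; ring. Qed.

Lemma aff_root u v a b : a < b -> aff u v a * aff u v b < 0 ->
  exists2 r, a < r < b & aff u v r = 0.
Proof.
rewrite !affE => ab H.
have uv : v - u != 0.
  by apply: contraTneq H => ->; rewrite !mulr0 addr0 -leNgt -expr2 sqr_ge0.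
exists (- u / (v - u)); last by rewrite affE divfK // subrr.
have E s : u + s * (v - u) = (s - - u / (v - u)) * (v - u) by field.
rewrite !E mulrACA -expr2 pmulr_llt0 in H; last by rewrite exprn_even_gt0.
set r := - u / (v - u) in H *.
apply/andP; split; rewrite ltNge; apply: contraTN H => H; rewrite -leNgt.
  by rewrite mulr_ge0 //; lra.
by rewrite mulr_le0 //; lra.
Qed.

Lemma aff_flip u v a b c : a < c < b -> aff u v c = 0 ->
  aff u v a != 0 -> aff u v a * aff u v b < 0.
Proof.
move=> /andP[ac cb]; rewrite !affE => c0 a0.
have uE : u = - (c * (v - u)) by lra.
set k := v - u in uE a0 *.
have -> : (u + a * k) * (u + b * k) = - ((c - a) * (b - c) * k ^+ 2) by rewrite uE; ring.
rewrite oppr_lt0; apply: mulr_gt0; first by apply: mulr_gt0; lra.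
rewrite exprn_even_gt0 //=.
by apply: contraNneq a0 => k0; rewrite uE k0 !mulr0 oppr0 addr0.
Qed.

(** The nonzero vector [(1 - c, c)] is in the kernel of the 2 by 2 matrix of end values, whose
    determinant therefore vanishes. *)
Lemma aff_inj u v u' v' c : aff u v c = 0 -> aff u' v' c = 0 -> u * v' = u' * v.
Proof.
rewrite /aff => e e'.
have : (1 - c) * (u * v' - u' * v) = 0.
  have -> : (1 - c) * (u * v' - u' * v) =
     ((1 - c) * u + c * v) * v' - ((1 - c) * u' + c * v') * v by ring.
  by rewrite e e' !mul0r subrr.
have : c * (u * v' - u' * v) = 0.
  have -> : c * (u * v' - u' * v) =
     ((1 - c) * u' + c * v') * u - ((1 - c) * u + c * v) * u' by ring.
  by rewrite e e' !mul0r subrr.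
lra.
Qed.

End Affine.

(** * Moving the target along segments, and vanishing of supported cocycles *)

Section Vanishing.
Variables (R : realFieldType) (d : nat) (X : finType).
Implicit Types (A : 'I_d -> {set X}) (J : {set 'I_d}) (x w : 'rV[R]_d).
Implicit Types (e : X) (t : {ffun 'I_d -> X}) (f : {ffun 'I_d -> X} -> R).
Variable pos : 'I_d -> X -> 'rV[R]_d.

(** The target runs along the segment, and [cross] is applied at each critical time in turn. The
    third hypothesis prevents two coordinates of one tuple from vanishing at the same time. *)
Lemma move_target A J x x' f :
  indep pos A -> (forall j, j \in J -> balanced (pos j) (A j)) ->
  generic pos A J x -> generic pos A J x' ->
  (forall t i j, t \in family A -> i \in J -> j \in J -> i != j ->
    coord (at_ pos t) i x * coord (at_ pos t) j x' !=
    coord (at_ pos t) j x * coord (at_ pos t) i x') ->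
  (forall J0 : {set 'I_d}, J0 \proper J -> vanishing pos J0) ->
  supported pos A J x f -> halfspace_cocyc pos A J f ->
  exists f', [/\ supported pos A J x' f', cocyc A J (fun t => f t - f' t) &
    (exists2 t, t \in family A & f t != 0) ->
    exists2 t, t \in family A & f' t != 0].
Proof.
move=> indA balA genx genx' transv IH suppf halff.
pose path s : 'rV[R]_d := (1 - s) *: x + s *: x'.
pose c t j := coord (at_ pos t) j.
have cpath t j s : c t j (path s) = aff (c t j x) (c t j x') s.
  by rewrite /c /path coordD !coordZ.
(* The zero of [u + s * (v - u)] is [u / (u - v)]. Coordinates constant along the path are nonzero
   by genericity and are filtered out. *)
pose cr := [seq c p.1 p.2 x / (c p.1 p.2 x - c p.1 p.2 x') |
   p <- [seq p <- [seq (t, j) | t <- enum (family A), j <- enum J] |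
           c p.1 p.2 x - c p.1 p.2 x' != 0]].
have incr t j s : t \in family A -> j \in J -> c t j (path s) = 0 -> s \in cr.
  move=> tA jJ; rewrite cpath affE => s0; have x0 := genx _ _ tA jJ.
  rewrite -/(c t j x) in x0; have k0 : c t j x - c t j x' != 0.
    apply: contraNneq x0 => k0; apply/eqP.
    by move: s0; rewrite -[c t j x' - _]opprB k0 oppr0 mulr0 addr0.
  apply/mapP; exists (t, j).
    by rewrite mem_filter k0; apply: allpairs_f; rewrite mem_enum.
  by rewrite /=; apply: (mulIf k0); rewrite divfK //; move: s0; lra.
have gen s : s \notin cr -> generic pos A J (path s).
  by move=> scr t j tA jJ; apply: contraNneq scr; exact: incr.
pose P s := exists f', [/\ supported pos A J (path s) f',
  cocyc A J (fun t => f t - f' t) &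
  (exists2 t, t \in family A & f t != 0) -> exists2 t, t \in family A & f' t != 0].
have path0 : path 0 = x by rewrite /path subr0 scale1r scale0r addr0.
have path1 : path 1 = x' by rewrite /path subrr scale1r scale0r add0r.
have notcr s : generic pos A J (path s) -> s \notin cr.
  move=> g; apply/mapP => -[[t j]]; rewrite mem_filter => /andP[/= k0].
  case/allpairsP => -[t' j'] /= [tA jJ [et ej]] sE; subst t' j'.
  rewrite !mem_enum in tA jJ; case/eqP: (g t j tA jJ).
  by rewrite -/(c t j _) cpath affE sE -[c t j x' - _]opprB mulrN divfK // subrr.
suff : P 1 by rewrite /P path1.
apply: (@sweep_ind _ P cr _ 0 1) => //; rewrite ?notcr ?path0 ?path1 //; last first.
  rewrite /P path0; exists f; split=> // a b _ _; apply: osum_eq0 => S _; exact: subrr.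
(* A single crossing: [path cc] plays the role of [w], between [path a] and [path b]. *)
move=> a cc b /andP[ac cb] acr bcr only [f1 [supp1 coc1 nz1]].
have half1 : halfspace_cocyc pos A J f1.
  move=> t i a' b' tA iJ aA bA h1 h2 h3; have := coc1 _ _ aA bA.
  rewrite osumB (halff t i) // sub0r => /eqP; rewrite oppr_eq0 => /eqP //.
have flip t j : t \in family A -> j \in J -> c t j (path cc) = 0 ->
    c t j (path a) * c t j (path b) < 0.
  rewrite !cpath => tA jJ h; apply: aff_flip h _; first by rewrite ac.
  by rewrite -cpath; apply: gen.
have sgE (u v : R) : u != 0 -> v != 0 -> ~ (u * v < 0) -> Num.sg u = Num.sg v.
  move=> u0 v0 h.
  case: (sgrP u) u0 h => // u0 _; case: (sgrP v) v0 => // v0 _ [];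
    by [rewrite pmulr_rlt0 | rewrite nmulr_rlt0].
have nearw t j : t \in family A -> j \in J -> c t j (path cc) != 0 ->
  Num.sg (c t j (path a)) = Num.sg (c t j (path cc))
     /\ Num.sg (c t j (path b)) = Num.sg (c t j (path cc)).
  move=> tA jJ c0; split; apply: sgE => //; try by apply: gen.
    rewrite !cpath => /(aff_root ac)[r /andP[ar rc] r0].
    suff e : r = cc by rewrite e ltxx in rc.
    apply: only; first by apply: (incr t j) => //; rewrite cpath.
    by rewrite ar (lt_trans rc).
  rewrite mulrC !cpath => /(aff_root cb)[r /andP[cr' rb] r0].
  suff e : r = cc by rewrite e ltxx in cr'.
  apply: only; first by apply: (incr t j) => //; rewrite cpath.
  by rewrite rb (lt_trans ac).
have onew t i j : t \in family A -> i \in J -> j \in J ->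
  c t i (path cc) = 0 -> c t j (path cc) = 0 -> i = j.
  move=> tA iJ jJ; rewrite !cpath => hi hj; apply/eqP.
  have := transv t i j tA iJ jJ; case: eqP => // _ /(_ isT) /eqP[].
  exact: aff_inj hi hj.
exists (cross pos A J (path a) (path cc) f1); split.
- exact: (supported_cross indA balA (gen _ acr) nearw flip onew IH supp1 half1).
- move=> a' b' aA bA.
  have := cocyc_cross J (path a) (path cc) indA f1 aA bA.
  have := coc1 _ _ aA bA; rewrite !osumB => e1 e2.
  by rewrite -(subrKA (osum J f1 a' b')) e1 e2 addr0.
- move=> /nz1[t tA]; exact: (cross_neq0 indA balA (gen _ acr) nearw onew IH supp1 half1).
Qed.

Definition coord_form t j : 'cV[R]_d := col j (invmx (rows_mx (at_ pos t))).

Lemma coord_formE t j x : (x *m coord_form t j) 0 0 = coord (at_ pos t) j x.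
Proof. by rewrite coordE. Qed.

(** [generic_near] is applied to the coordinate forms [us] and to the forms [vs], which vanish at
    [y] exactly when transversality fails; the latter are nonzero because [x] is generic. *)
Lemma generic_target A J x z : indep pos A -> generic pos A J x ->
  exists y, [/\ generic pos A J y,
    forall t i j, t \in family A -> i \in J -> j \in J -> i != j ->
      coord (at_ pos t) i x * coord (at_ pos t) j y !=
      coord (at_ pos t) j x * coord (at_ pos t) i y &
    forall t j, t \in family A -> 0 < coord (at_ pos t) j z ->
      0 < coord (at_ pos t) j y].
Proof.
move=> indA genx.
pose us := [seq coord_form p.1 p.2 | p <- [seq (t, j) | t <- enum (family A), j <- enum 'I_d]].
pose vs := [seq coord (at_ pos p.1) p.2.1 x *: coord_form p.1 p.2.2 -
                coord (at_ pos p.1) p.2.2 x *: coord_form p.1 p.2.1 |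
  p <- [seq (t, p) | t <- enum (family A),
     p <- [seq p <- [seq (i, j) | i <- enum J, j <- enum J] | p.1 != p.2]]].
have [|y Hy] := @generic_near _ _ (us ++ vs) z.
  rewrite mem_cat negb_or; apply/andP; split; apply/mapP.
    move=> -[[t j]] /allpairsP[[t' j'] /= [tA _ [-> ->]]] e.
    rewrite mem_enum in tA; have := coord_formE t' j' (at_ pos t' j').
    by rewrite -e mulmx0 mxE coord_self ?indA // eqxx => /eqP; rewrite eq_sym oner_eq0.
  move=> -[[t [i j]]] /allpairsP[[t' [i' j']] /= [tA]].
  rewrite mem_filter => /andP[/= ij /allpairsP[[i'' j''] /= [iJ jJ [ei ej]]]] [-> -> ->] e.
  subst i'' j''; rewrite !mem_enum in tA iJ jJ.
  have := congr1 (fun u => (at_ pos t' j' *m u) 0 0) e.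
  rewrite mulmx0 mxE mulmxBr mxE [in X in _ + X]mxE -!scalemxAr.
  rewrite [in X in X - _]mxE [in X in _ - X]mxE !coord_formE !coord_self ?indA //.
  rewrite eqxx eq_sym in ij *; rewrite (negPf ij) mulr1 mulr0 subr0 => /esym/eqP.
  by rewrite (negPf (genx _ _ tA iJ)).
have inus t j : t \in family A -> coord_form t j \in us ++ vs.
  move=> tA; rewrite mem_cat; apply/orP; left; apply/mapP; exists (t, j) => //.
  by apply: allpairs_f; rewrite mem_enum.
exists y; split.
- by move=> t j tA jJ; have [] := Hy _ (inus t j tA); rewrite coord_formE.
- move=> t i j tA iJ jJ ij.
  have [|] := Hy (coord (at_ pos t) i x *: coord_form t j -
                coord (at_ pos t) j x *: coord_form t i).
    rewrite mem_cat; apply/orP; right; apply/mapP; exists (t, (i, j)) => //.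
    apply: allpairs_f; rewrite ?mem_enum // mem_filter ij.
    by apply: allpairs_f; rewrite mem_enum.
  rewrite mulmxBr -!scalemxAr !mxE -/(coord_form t j) -/(coord_form t i).
  by rewrite -!coord_formE !mxE subr_eq0.
- by move=> t j tA; have [_] := Hy _ (inus t j tA); rewrite !coord_formE.
Qed.

(* Move [x] close to a vertex [pos i (t i)]: then no simplex with that vertex
   hits, so that every slice of the function is a cocycle in fewer colors. *)
Theorem vanishing_all J : vanishing pos J.
Proof.
have [n] := ubnP #|J|; elim: n J => // n IHn J ltJn.
have IH (J0 : {set 'I_d}) : J0 \proper J -> vanishing pos J0.
  by move=> /proper_card J0J; apply: IHn; apply: leq_trans J0J _.
move=> A x f indA balA genx suppf cocf t tA.
case: (set_0Vmem J) => [J0|[i iJ]].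
  by have := cocf t t tA tA; rewrite J0 osum0.
have [y [geny transv near]] := generic_target (pos i (t i)) indA genx.
have [|f' [supp' coc' nz]] := move_target indA balA genx geny transv IH suppf.
  by move=> *; apply: cocf.
have cocf' a b : a \in family A -> b \in family A -> osum J f' a b = 0.
  move=> aA bA; have := coc' _ _ aA bA; rewrite osumB cocf // sub0r.
  by move/eqP; rewrite oppr_eq0 => /eqP.
apply/eqP/negPn/negP => ft; have [|t' t'A /eqP[]] := nz; first by exists t.
have zero s : s \in family A -> s i = t i -> f' s = 0.
  move=> sA si; apply/eqP/negPn/negP => /(supp' _ sA)/forall_inP/(_ i iJ).
  have := near s i sA; rewrite -si -/(at_ pos s i) coord_self ?indA // eqxx ltr01.
  by move=> /(_ isT) h1 h2; have := lt_trans h1 h2; rewrite ltxx.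
pose A' j := if j == i then [set t' i] else A j.
have A'A s : s \in family A' -> s \in family A.
  move=> sA; apply/familyP => j; move: (familyP sA j); rewrite /A'.
  by case: eqP => // -> /set1P ->; exact: (familyP t'A).
apply: (IH (J :\ i) (properD1 iJ) A' y f') => //.
- by move=> s /A'A /indA.
- by move=> j; rewrite !inE /A' => /andP[/negPf -> /balA].
- by move=> s j /A'A sA /setD1P[_ jJ]; apply: geny.
- move=> s /A'A sA /(supp' _ sA)/forall_inP h; apply/forall_inP => j /setD1P[_].
  exact: h.
- move=> a b /A'A aA /A'A bA.
  have tiA : t i \in A i by exact: (familyP tA).
  (* Take [t i] as antipode in direction [i]: the vertices at [t i] contribute 0, so what remains is
     the sum for the slice at [t' i]. *)
  have := cocf' a (upd b i (t i)) aA (upd_family bA tiA).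
  rewrite (osum_split _ _ _ iJ) !osum_updr upd_id => /eqP.
  rewrite subr_eq0 => /eqP ->; apply: osum_eq0 => S /subsetD1P[_ iS].
  apply: zero; first by apply: mix_family => //; apply: upd_family.
  by rewrite ffunE (negPf iS) upd_id.
- apply/familyP => j; rewrite /A'; case: eqP => [->|_]; rewrite ?set11 //.
  exact: (familyP t'A).
Qed.

End Vanishing.

(** * Rigidity of functions supported on hitting tuples *)

Section Rigidity.
Variables (R : realFieldType) (d : nat) (X : finType).
Implicit Types (A : 'I_d -> {set X}) (J : {set 'I_d}) (m : 'I_d -> 'rV[R]_d).
Implicit Types (pos : 'I_d -> X -> 'rV[R]_d) (pv : X -> 'rV[R]_d) (V : {set X}).
Implicit Types (t : {ffun 'I_d -> X}).

Lemma basis_exchange m m' i : rows_mx m \in unitmx ->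
  (forall k, k != i -> m' k = m k) -> coord m i (m' i) != 0 ->
  rows_mx m' \in unitmx.
Proof.
move=> mU mm' c0; rewrite -row_free_unit; apply: inj_row_free => v.
rewrite mulmx_sum_row => v0.
have vi : v 0 i = 0.
  have := congr1 (coord m i) v0; under eq_bigr => k _ do rewrite rowK.
  rewrite coord_lin (bigD1 i) //= big1 ?addr0 => [|k ki].
    rewrite coord0 => /eqP.
    by rewrite mulf_eq0 (negPf c0) orbF => /eqP.
  by rewrite mm' // coord_self // (negPf ki) mulr0.
have vE : \sum_k v 0 k *: m k = 0.
  rewrite -[RHS]v0; apply: eq_bigr => k _; rewrite rowK.
  by case: (eqVneq k i) => [->|/mm' -> //]; rewrite vi !scale0r.
apply/rowP => j; rewrite mxE -(coord_uniq (fun k => v 0 k) j mU) vE.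
exact: coord0.
Qed.

(** By balance some [w] in [V] lies strictly inside the halfspace. No simplex in the halfspace has
    [- w] in its cone, so the slice at [w] vanishes on the octahedron, and the slice at [v0] differs
    from it by a cocycle. *)
Lemma halfspace_of_cocyc pos A J pv V f v0 :
  indep pos A ->
  (forall t v j, t \in family A -> v \in V -> coord (at_ pos t) j (pv v) != 0) ->
  balanced pv V ->
  (forall v w, v \in V -> w \in V -> cocyc A J (fun t => f v t - f w t)) ->
  (forall v, v \in V -> supported pos A J (pv v) (f v)) ->
  v0 \in V -> halfspace_cocyc pos A J (f v0).
Proof.
move=> indA genV balV cocf suppf v0V t i a b tA iJ aA bA ha hb h0.
have [|w wV uw] := balanced_pos (u := coord_form pos t i) balV.
  by exists v0; rewrite ?coord_formE ?genV.
rewrite coord_formE in uw.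
have := cocf _ _ v0V wV a b aA bA; rewrite osumB => /eqP.
rewrite subr_eq0 => /eqP ->; apply: osum_eq0 => S SJ.
have sA := mix_family S aA bA; set s := mix S a b in sA *.
apply/eqP/negPn/negP => /(suppf _ wV _ sA)/forall_inP hs.
move: uw; rewrite ltNge => /negP; apply.
rewrite [pv w](coord_sum _ (indA _ sA)) coord_lin -oppr_ge0 -sumrN.
apply: sumr_ge0 => k _; rewrite oppr_ge0 [X in coord (at_ pos t) i X]/at_ ffunE.
case: (boolP (k \in J)) => kJ; last first.
  by rewrite ifN ?h0 ?mulr0 //; apply: contra kJ; apply: (subsetP SJ).
apply: mulr_le0_ge0; first by rewrite ltW ?hs.
by case: ifP => _; rewrite ?ha ?hb.
Qed.

(* Move [pv v0] to [- pv v0].  The two resulting functions have disjoint supports,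
   and their difference lives on the simplices met by the line through [pv v0]:
   this is the same situation with [pv v0] as a fixed direction and the class
   [A k] in the role of [V]. *)
Theorem rigidity pos A J pv V f t0 v0 :
  indep pos A ->
  (forall t v j, t \in family A -> v \in V -> coord (at_ pos t) j (pv v) != 0) ->
  (forall j, j \in J -> balanced (pos j) (A j)) -> balanced pv V ->
  (forall j, j \notin J -> A j = [set t0 j]) ->
  (forall v w, v \in V -> w \in V -> cocyc A J (fun t => f v t - f w t)) ->
  (forall v, v \in V -> supported pos A J (pv v) (f v)) ->
  t0 \in family A -> v0 \in V -> hits pos J (pv v0) t0 -> f v0 t0 = 0 ->
  forall v t, v \in V -> t \in family A -> f v t = 0.
Proof.
have [n] := ubnP #|J|; elim: n J pos A pv V f t0 v0 => // n IH J pos A pv V f t0 v0 ltJn.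
move=> indA genV balA balV AJ cocf suppf t0A v0V ht0 ft0.
(* Once the slice at [v0] vanishes, every other slice is a cocycle and [vanishing_all] applies to
   it. *)
suff fv0 t : t \in family A -> f v0 t = 0.
  move=> v t vV tA; apply: (vanishing_all indA balA _ (suppf v vV)) => //.
    by move=> s j sA _; apply: genV.
  move=> a b aA bA; have := cocf _ _ vV v0V a b aA bA; rewrite osumB.
  rewrite [X in _ - X]osum_eq0 ?subr0 // => S _; apply: fv0.
  exact: mix_family.
case: (set_0Vmem J) => [J0|[k kJ]].
  move=> tA; suff -> : t = t0 by [].
  apply/ffunP => j; move/familyP/(_ j): tA; rewrite AJ ?J0 ?inE // => /eqP //.
set x := pv v0.
have genx : generic pos A J x by move=> s j sA _; apply: genV.
(* The segment from [x] to [- x] passes through 0, where all coordinates vanish at once; a detour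
   through a generic [y] avoids this. *)
have [y [geny transv _]] := generic_target 0 indA genx.
have half0 := halfspace_of_cocyc indA genV balV cocf suppf v0V.
have [f1 [supp1 coc1 _]] := move_target indA balA genx geny transv
  (fun J0 _ => @vanishing_all _ _ _ _ J0) (suppf _ v0V) half0.
have half1 : halfspace_cocyc pos A J f1.
  move=> s i a b sA iJ aA bA h1 h2 h3; have := coc1 _ _ aA bA.
  by rewrite osumB (half0 s i) // sub0r => /eqP; rewrite oppr_eq0 => /eqP.
have genNx : generic pos A J (- x).
  by move=> s j sA jJ; rewrite coordN oppr_eq0 genx.
have [|f2 [supp2 coc2 _]] := move_target indA balA geny genNx _
  (fun J0 _ => @vanishing_all _ _ _ _ J0) supp1 half1.
  move=> s i j sA iJ jJ ij; rewrite !coordN !mulrN eqr_opp.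
  by rewrite mulrC [X in _ != X]mulrC eq_sym; apply: transv.
have excl s : hits pos J x s -> hits pos J (- x) s -> False.
  move=> /forall_inP/(_ k kJ) h1 /forall_inP/(_ k kJ); rewrite coordN oppr_lt0.
  by move=> h2; have := lt_trans h1 h2; rewrite ltxx.
pose h s := f v0 s - f2 s.
have coch : cocyc A J h.
  move=> a b aA bA; rewrite osumB; apply/eqP; rewrite subr_eq0.
  have := coc1 _ _ aA bA; rewrite osumB => /eqP; rewrite subr_eq0 => /eqP ->.
  by have := coc2 _ _ aA bA; rewrite osumB => /eqP; rewrite subr_eq0.
suff h0 : forall s, s \in family A -> h s = 0.
  move=> tA; apply/eqP/negPn/negP => ft; have /eqP := h0 _ tA.
  rewrite subr_eq0 => /eqP fE; apply: (excl t); first exact: suppf ft.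
  by apply: supp2; rewrite -?fE.
pose pos' j := if j == k then pv else pos j.
pose A' j := if j == k then [set v0] else A j.
have A'k s : s \in family A' -> s k = v0.
  by move=> sA; move: (familyP sA k); rewrite /A' eqxx => /set1P.
have A'A s e : s \in family A' -> e \in A k -> upd s k e \in family A.
  move=> sA eA; apply/familyP => j; rewrite updE; case: eqP => [->//|/eqP jk].
  by move: (familyP sA j); rewrite /A' (negPf jk).
have AA' s : s \in family A -> upd s k v0 \in family A'.
  move=> sA; apply/familyP => j; rewrite updE /A'; case: eqP => [_|_].
    exact: set11.
  exact: (familyP sA).
have mm' s e j : s \in family A' -> j != k -> at_ pos' s j = at_ pos (upd s k e) j.
  by move=> sA jk; rewrite /at_ /pos' updE (negPf jk).
have m'k s : s \in family A' -> at_ pos' s k = x.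
  by move=> sA; rewrite /at_ /pos' eqxx A'k.
have m'U s e : s \in family A' -> e \in A k -> rows_mx (at_ pos' s) \in unitmx.
  move=> sA eA; apply: (basis_exchange (indA _ (A'A _ _ sA eA))).
    by move=> j; apply: mm'.
  by rewrite m'k //; apply: genV => //; apply: A'A.
have tkA s : s \in family A -> s k \in A k by move=> sA; exact: (familyP sA).
have c'k s e : s \in family A' -> e \in A k ->
    coord (at_ pos (upd s k e)) k x * coord (at_ pos' s) k (pos k e) = 1.
  move=> sA eA; have := coord_swap (indA _ (A'A _ _ sA eA)) (m'U _ _ sA eA)
    (fun j => mm' s e j sA).
  by rewrite m'k // [X in coord (at_ pos' s) k X]/at_ upd_id.
have c'j s e j : s \in family A' -> e \in A k -> j != k ->
    coord (at_ pos (upd s k e)) k x * coord (at_ pos' s) j (pos k e) =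
    - coord (at_ pos (upd s k e)) j x.
  move=> sA eA jk.
  have := coord_upd j x (indA _ (A'A _ _ sA eA)) (m'U _ _ sA eA)
    (fun j => mm' s e j sA).
  rewrite -{1}(m'k _ sA) coord_self ?(m'U s e) // eq_sym jk (negPf jk) mul1r.
  rewrite [X in coord (at_ pos' s) j X]/at_ upd_id => /esym/eqP.
  by rewrite addrC addr_eq0 => /eqP.
(* In either case the coordinates [j] and [k] of [x] have equal signs, and the coordinate [j] of the
   exchanged vector is minus their quotient, hence negative. *)
have hits' s e : s \in family A' -> e \in A k ->
   hits pos J x (upd s k e) \/ hits pos J (- x) (upd s k e) ->
   hits pos' (J :\ k) (pos k e) s.
  move=> sA eA hh; apply/forall_inP => j /setD1P[jk jJ].
  have := c'j _ _ _ sA eA jk; case: hh => /forall_inP hh.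
    have := hh _ jJ; rewrite -oppr_gt0 => + E; rewrite -E.
    by rewrite nmulr_rgt0 // hh.
  have := hh _ jJ; rewrite coordN => + E; rewrite -E pmulr_rlt0 //.
  by have := hh _ kJ; rewrite coordN oppr_lt0.
move=> s sA; have t0A' := AA' _ t0A.
have -> : h s = h (upd (upd s k v0) k (s k)) by rewrite upd_upd updK.
apply: (IH (J :\ k) pos' A' (pos k) (A k) (fun e s => h (upd s k e)) (upd t0 k v0) (t0 k));
  rewrite ?tkA ?AA' //.
- by apply: leq_trans (proper_card (properD1 kJ)) _.
- by move=> s' s'A; apply: (m'U s' (t0 k)) => //; apply: tkA.
- move=> s' e j s'A eA; apply/negP => /eqP c0; case: (eqVneq j k) => [jk|jk].
    rewrite jk in c0; have := c'k _ _ s'A eA; rewrite c0 mulr0.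
    by move=> /esym/eqP; rewrite oner_eq0.
  have := c'j _ _ _ s'A eA jk; rewrite c0 mulr0 => /esym/eqP; rewrite oppr_eq0.
  by apply/negP; apply: genV => //; apply: A'A.
- by move=> j /setD1P[jk jJ]; rewrite /pos' /A' (negPf jk); apply: balA.
- exact: balA.
- move=> j; rewrite !inE /A' updE; case: eqP => //= _; exact: AJ.
(* Splitting off direction [k] in an octahedral sum of [h] yields the difference of its slices at
   [e] and [e']. *)
- move=> e e' eA e'A a b aA bA; rewrite osumB.
  have aeA := A'A _ _ aA eA; have ae'A := A'A _ _ bA e'A.
  have := coch _ _ aeA ae'A; rewrite (osum_split _ _ _ kJ) !osum_updr upd_upd upd_id.
  have E q : osum (J :\ k) h (upd a k q) b = osum (J :\ k) (fun s => h (upd s k q)) a b.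
    apply: eq_bigr => S; rewrite inE => /subsetD1P[_ kS]; congr (_ * h _).
    apply/ffunP => j; rewrite !ffunE; case: (eqVneq j k) => // ->.
    by rewrite (negPf kS).
  by rewrite !E.
- move=> e eA s' s'A hs; apply: hits' => //.
  case: (eqVneq (f v0 (upd s' k e)) 0) => f0; last first.
    by left; apply: suppf => //; apply: A'A.
  right; apply: supp2; first exact: A'A.
  by move: hs; rewrite /h f0 sub0r oppr_eq0.
- by apply: hits'; rewrite ?tkA // upd_upd updK; left.
(* The zero at [t0] is inherited by [h]: since [t0] hits [x], it cannot hit [- x], and [f2] vanishes
   there too. *)
- rewrite upd_upd updK /h ft0 sub0r; apply/eqP; rewrite oppr_eq0.
  by apply/negPn/negP => /(supp2 _ t0A); apply: excl.
Qed.

End Rigidity.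

(** * The dimension count for generic configurations *)

Section Counting.
Variables (R : realFieldType) (d : nat) (X : finType).
Implicit Types (A : 'I_d -> {set X}) (m dm : 'I_d -> 'rV[R]_d).
Implicit Types (pos : 'I_d -> X -> 'rV[R]_d) (pv : X -> 'rV[R]_d) (V : {set X}).
Implicit Types (t : {ffun 'I_d -> X}) (p : {ffun 'I_d -> X} * X).

Definition tuples A V := [set p | (p.1 \in family A) && (p.2 \in V)].

Definition hitting_tuple pos pv p :=
  (rows_mx (at_ pos p.1) \in unitmx) && hits pos [set: 'I_d] (pv p.2) p.1.

Definition good_tuple pos pv p :=
  (rows_mx (at_ pos p.1) \in unitmx) && [forall j, coord (at_ pos p.1) j (pv p.2) != 0].

Lemma hitting_good pos pv p : hitting_tuple pos pv p -> good_tuple pos pv p.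
Proof.
move=> /andP[mU /forall_inP h]; rewrite /good_tuple mU; apply/forallP => j.
by rewrite lt_eqF // h.
Qed.

Lemma card_tuples A V : #|tuples A V| = (#|V| * \prod_j #|A j|)%N.
Proof.
have -> : tuples A V = setX [set t in family A] V.
  by apply/setP => -[t v]; rewrite !inE.
rewrite cardsX mulnC cardsE card_family foldrE big_image /=; congr (_ * _)%N.
Qed.

(** Fix a hitting tuple [(o, v0)]; [Q] indexes the octahedra with this apex by their antipodal
    tuples. If the other hitting tuples outnumbered [Q], some nonzero function supported on them
    would be killed by all octahedra and vanish at [(o, v0)], against [rigidity]. *)
Theorem card_hitting_generic pos A pv V :
  (forall p, p \in tuples A V -> good_tuple pos pv p) ->
  (forall j, balanced (pos j) (A j)) -> balanced pv V ->
  (#|[set p in tuples A V | hitting_tuple pos pv p]| <=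
     1 + (#|V| - 1) * \prod_j (#|A j| - 1))%N.
Proof.
move=> good balA balV; set P := [set p in _ | _].
case: (set_0Vmem P) => [->|[[o v0] oP]]; first by rewrite cards0.
move: (oP); rewrite !inE /= => /andP[/andP[oA v0V] oh].
have oj j : o j \in A j by exact: (familyP oA).
pose Q := tuples (fun j => A j :\ o j) (V :\ v0).
have cQ : #|Q| = ((#|V| - 1) * \prod_j (#|A j| - 1))%N.
  rewrite card_tuples [in RHS](cardsD1 v0) v0V add1n subn1 /=; congr (_ * _)%N.
  by apply: eq_bigr => j _; rewrite [in RHS](cardsD1 (o j)) oj add1n subn1.
rewrite -cQ (cardsD1 (o, v0) P) oP leq_add2l leqNgt; apply/negP => ltQP.
set P' := P :\ (o, v0) in ltQP.
pose ev (i : 'I_#|P'|) : {ffun 'I_d -> X} -> X -> R := fun t w => (enum_val i == (t, w))%:R.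
(* Rows are indicators of hitting tuples, columns are octahedra; a vector in the left kernel is a
   combination killed by all octahedra of [Q]. *)
pose K := \matrix_(i < #|P'|, c < #|Q|)
  osum [set: 'I_d] (fun t => ev i t (enum_val c).2 - ev i t v0) o (enum_val c).1.
have : kermx K != 0.
  rewrite -mxrank_eq0 mxrank_ker subn_eq0 -ltnNge.
  exact: leq_ltn_trans (rank_leq_col K) ltQP.
case/rowV0Pn => l /sub_kermxP lK l0.
pose f w t := \sum_i l 0 i * ev i t w.
have indA : indep pos A.
  by move=> t tA; have /good/andP[] : (t, v0) \in tuples A V by rewrite inE tA.
have genV t v j : t \in family A -> v \in V -> coord (at_ pos t) j (pv v) != 0.
  move=> tA vV; have /good/andP[_ /forallP/(_ j)] // : (t, v) \in tuples A V.
  by rewrite inE tA.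
have fP t w : f w t != 0 -> (t, w) \in P'.
  apply: contraR => twP; rewrite /f big1 // => i _; rewrite /ev.
  case: eqP => [e|]; rewrite ?mulr0 //.
  by move: (enum_valP i); rewrite e (negPf twP).
have base w : w \in V -> cocyc A [set: 'I_d] (fun t => f w t - f v0 t).
  move=> wV; apply: (osum_base oA); last by move=> j; rewrite inE.
  move=> b bA bo; have [->|wv] := eqVneq w v0.
    by apply: osum_eq0 => S _; rewrite subrr.
  have bQ : (b, w) \in Q.
    rewrite [_ \in Q]inE /= in_setD1 wv wV /= andbT; apply/familyP => j.
    by rewrite !inE bo ?inE // (familyP bA).
  have := congr1 (fun M : 'rV_#|Q| => M 0 (enum_rank_in bQ (b, w))) lK.
  rewrite /= mxE [X in _ = X]mxE => <-; rewrite /osum.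
  under [RHS]eq_bigr => i _ do rewrite mxE (enum_rankK_in bQ bQ) /= /osum mulr_sumr.
  rewrite exchange_big /=; apply: eq_bigr => S _; rewrite /f -sumrB mulr_sumr.
  by apply: eq_bigr => i _; ring.
have cocf v w : v \in V -> w \in V -> cocyc A [set: 'I_d] (fun t => f v t - f w t).
  move=> vV wV a b aA bA; have := base _ vV a b aA bA; have := base _ wV a b aA bA.
  by rewrite !osumB; lra.
have := rigidity (J := [set: 'I_d]) indA genV (fun j _ => balA j) balV _ cocf _ oA v0V.
move=> /(_ _ _) H; case/eqP: l0; apply/rowP => i; rewrite [RHS]mxE.
have iP := enum_valP i; case E : (enum_val i) iP => [t w] iP.
have -> : l 0 i = f w t.
  rewrite /f (bigD1 i) //= /ev E eqxx mulr1 big1 ?addr0 // => k ki.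
  by rewrite -E (inj_eq enum_val_inj) (negPf ki) mulr0.
move: (iP); rewrite !inE => /and3P[_ /andP[tA wV] _].
apply: H => //.
- by move=> j; rewrite inE.
- by move=> v vV s sA /fP; rewrite !inE => /and3P[_ _ /andP[]].
- by case/andP: oh.
by apply/eqP/negPn/negP => /fP; rewrite !inE eqxx.
Qed.

End Counting.

(** * Perturbation to generic configurations *)

Section Perturbation.
Variables (R : realFieldType) (d : nat) (X : finType).
Implicit Types (A : 'I_d -> {set X}) (m dm : 'I_d -> 'rV[R]_d) (z dz : 'rV[R]_d).
Implicit Types (pos : 'I_d -> X -> 'rV[R]_d) (pv : X -> 'rV[R]_d) (V B : {set X}).
Implicit Types (t : {ffun 'I_d -> X}) (p : {ffun 'I_d -> X} * X).

Definition repl m j z : 'I_d -> 'rV[R]_d := fun k => if k == j then z else m k.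

Lemma cramer m j z : rows_mx m \in unitmx ->
  \det (rows_mx (repl m j z)) = coord m j z * \det (rows_mx m).
Proof.
move=> mU; have D0 : \det (rows_mx m) != 0 by rewrite unitmxE unitfE in mU.
rewrite /coord /invmx mU -scalemxAr mxE mulrAC mulVf // mul1r.
rewrite (expand_det_row _ j) mxE; apply: eq_bigr => k _.
rewrite !mxE /repl eqxx; congr (_ * _); rewrite /cofactor; congr (_ * \det _).
apply/matrixP => a b; rewrite !mxE /repl; case: eqP => // e.
by move: (neq_lift j a); rewrite e eqxx.
Qed.

(** The vectors move linearly with time ['X], so determinants become polynomials in time. *)
Definition pencil m dm : 'M[{poly R}]_d :=
  \matrix_(j, k) ((m j 0 k)%:P + (dm j 0 k) *: 'X).

Lemma det_pencil m dm e :
  (\det (pencil m dm)).[e] = \det (rows_mx (fun j => m j + e *: dm j)).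
Proof.
rewrite -[LHS]/(horner_eval e _) -det_map_mx; congr (\det _).
apply/matrixP => j k; rewrite !mxE -[LHS]/(horner _ _).
by rewrite hornerD hornerC hornerZ hornerX mulrC.
Qed.

Definition shift (f df : X -> 'rV[R]_d) e : X -> 'rV[R]_d := fun x => f x + e *: df x.

Lemma shift0 f df x : shift f df 0 x = f x.
Proof. by rewrite /shift scale0r addr0. Qed.

Lemma eq_det_basis m m' : m =1 m' -> \det (rows_mx m) = \det (rows_mx m').
Proof.
by move=> mm'; congr (\det _); apply/matrixP => i j; rewrite !mxE mm'.
Qed.

Definition tuple_dets pos pv p : R := \det (rows_mx (at_ pos p.1)) *
  \prod_j \det (rows_mx (repl (at_ pos p.1) j (pv p.2))).

Lemma good_dets pos pv p : good_tuple pos pv p = (tuple_dets pos pv p != 0).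
Proof.
rewrite /good_tuple /tuple_dets mulf_eq0 negb_or unitmxE unitfE.
case: eqP => //= /eqP D0; have mU : rows_mx (at_ pos p.1) \in unitmx by rewrite unitmxE unitfE.
apply/forallP/prodf_neq0 => [h j _|h j]; first by rewrite cramer // mulf_neq0.
by have := h j isT; rewrite cramer // mulf_eq0 negb_or => /andP[].
Qed.

(** Cramer's rule, with multiplication by the determinant in place of division: the sign is the same
    and the condition becomes polynomial. *)
Lemma hitting_dets pos pv p : hitting_tuple pos pv p =
  (\det (rows_mx (at_ pos p.1)) != 0) && [forall j,
  0 < - (\det (rows_mx (at_ pos p.1)) * \det (rows_mx (repl (at_ pos p.1) j (pv p.2))))].
Proof.
rewrite /hitting_tuple unitmxE unitfE; case: eqP => //= /eqP D0.
have mU : rows_mx (at_ pos p.1) \in unitmx by rewrite unitmxE unitfE.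
have E j : (0 < - (\det (rows_mx (at_ pos p.1)) *
     \det (rows_mx (repl (at_ pos p.1) j (pv p.2))))) = (coord (at_ pos p.1) j (pv p.2) < 0).
  by rewrite cramer // mulrCA oppr_gt0 pmulr_llt0 // -expr2 exprn_even_gt0.
apply/forall_inP/forallP => h j; first by rewrite E h.
by rewrite -E.
Qed.

(** The polynomials for [G] are nonzero because they have a nonzero value somewhere, and those for
    [H] have the right sign at 0; [small_polys] provides a common small time. *)
Lemma perturbation pos dpos pv dpv (G H : seq ({ffun 'I_d -> X} * X)) :
  (forall p, p \in G -> exists e,
     good_tuple (fun j => shift (pos j) (dpos j) e) (shift pv dpv e) p) ->
  (forall p, p \in H -> hitting_tuple pos pv p) ->
  exists e, (forall p, p \in G ->
     good_tuple (fun j => shift (pos j) (dpos j) e) (shift pv dpv e) p) /\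
   (forall p, p \in H ->
     hitting_tuple (fun j => shift (pos j) (dpos j) e) (shift pv dpv e) p).
Proof.
move=> hG hH.
pose D0 p := \det (pencil (at_ pos p.1) (at_ dpos p.1)).
pose Dj p j := \det (pencil (repl (at_ pos p.1) j (pv p.2)) (repl (at_ dpos p.1) j (dpv p.2))).
have D0E p e : (D0 p).[e] = \det (rows_mx (at_ (fun j => shift (pos j) (dpos j) e) p.1)).
  by rewrite det_pencil.
have DjE p j e : (Dj p j).[e] =
    \det (rows_mx (repl (at_ (fun j => shift (pos j) (dpos j) e) p.1) j (shift pv dpv e p.2))).
  by rewrite det_pencil; apply: eq_det_basis => k; rewrite /repl; case: eqP.
have TE p e : (D0 p * \prod_j Dj p j).[e] =
    tuple_dets (fun j => shift (pos j) (dpos j) e) (shift pv dpv e) p.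
  by rewrite hornerM horner_prod D0E; congr (_ * _); apply: eq_bigr => j _; rewrite DjE.
have at0 p : (D0 p).[0] = \det (rows_mx (at_ pos p.1)).
  by rewrite D0E; apply: eq_det_basis => k; rewrite /at_ shift0.
have atj0 p j : (Dj p j).[0] = \det (rows_mx (repl (at_ pos p.1) j (pv p.2))).
  by rewrite DjE; apply: eq_det_basis => k; rewrite /repl /at_ !shift0.
pose qs := [seq D0 p * \prod_j Dj p j | p <- G] ++ [seq D0 p | p <- H] ++
  [seq - (D0 q.1 * Dj q.1 q.2) | q <- [seq (p, j) | p <- H, j <- enum 'I_d]].
have hH' p : p \in H -> (D0 p).[0] != 0 /\ forall j, 0 < (- (D0 p * Dj p j)).[0].
  move=> /hH; rewrite hitting_dets => /andP[n0 /forallP h]; rewrite at0; split=> // j.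
  by rewrite hornerN hornerM at0 atj0.
have [|e e0 He] := @small_polys _ qs.
  rewrite !mem_cat !negb_or; apply/and3P; split; apply/mapP.
  - move=> [p /hG[e ge] E]; move: ge; rewrite good_dets -TE -E horner0 eqxx //.
  - by move=> [p /hH'[h _] E]; move: h; rewrite -E horner0 eqxx.
  move=> [_ /allpairsP[[p j] /= [pH _ ->]] E]; have [_ /(_ j)] := hH' _ pH.
  by rewrite /= -E horner0 ltxx.
exists e; split=> p pGH.
  rewrite good_dets -TE; apply: (He _ _).1; rewrite mem_cat; apply/orP; left.
  by apply/mapP; exists p.
rewrite hitting_dets -D0E; apply/andP; split.
  apply: (He _ _).1; rewrite !mem_cat; apply/orP; right; apply/orP; left.
  by apply/mapP; exists p.
apply/forallP => j; rewrite -DjE -hornerM -hornerN; apply: (He _ _).2.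
  rewrite !mem_cat; apply/orP; right; apply/orP; right.
  by apply/mapP; exists (p, j) => //; apply: allpairs_f; rewrite ?mem_enum.
exact: (hH' _ pGH).2.
Qed.

(* The displacement of [x] to [z] is compensated at another point of [B], so that
   the sum over [B] does not change. *)
Definition displace (f : X -> 'rV[R]_d) B x z y : 'rV[R]_d :=
  if y == x then z - f x
  else if Some y == [pick y in B :\ x] then f x - z else 0.

Lemma sum_displace f B x z : x \in B -> (2 <= #|B|)%N ->
  \sum_(y in B) displace f B x z y = 0.
Proof.
move=> xB B2; rewrite (bigD1 x) //= {1}/displace eqxx.
case E : [pick y in B :\ x] => [b|]; last first.
  move: E; case: pickP => // B0 _; move: B2; rewrite (cardsD1 x) xB.
  by rewrite (eq_card0 B0).
have : b \in B :\ x by move: E; case: pickP => // b' + [<-].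
move=> /setD1P[bx bB]; rewrite (bigD1 b) ?bB //= /displace (negPf bx) E eqxx.
rewrite big1 ?addr0 => [|y /andP[/andP[_ /negPf->] /negPf yb]].
  by rewrite addrA subrK subrr.
by case: eqP => // -[yE]; rewrite yE eqxx in yb.
Qed.

Lemma balanced_sum0 (f : X -> 'rV[R]_d) B : \sum_(x in B) f x = 0 -> balanced f B.
Proof.
move=> B0 u [x xB ux].
case: (pickP (fun y => (y \in B) && (0 < (f y *m u) 0 0))) => [y /andP[yB uy]|no].
  by exists y.
have : (\sum_(y in B) f y *m u) 0 0 = 0 by rewrite -mulmx_suml B0 mul0mx mxE.
rewrite summxE (bigD1 x) //= => E.
suff : \sum_(i in B | i != x) (f i *m u) 0 0 <= 0 by lra.
rewrite -oppr_ge0 -sumrN; apply: sumr_ge0 => y /andP[yB _]; rewrite oppr_ge0 leNgt.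
by have := no y; rewrite yB /= => ->.
Qed.

(* Moving a tuple in special position towards a hitting one makes it generic for
   all but finitely many times, in particular for some small time. *)
Theorem card_hitting pos A pv V :
  (forall j, \sum_(x in A j) pos j x = 0) -> \sum_(v in V) pv v = 0 ->
  (forall j, (2 <= #|A j|)%N) -> (2 <= #|V|)%N ->
  (#|[set p in tuples A V | hitting_tuple pos pv p]| <=
     1 + (#|V| - 1) * \prod_j (#|A j| - 1))%N.
Proof.
move=> sA sV A2 V2.
have [n] := ubnP #|[set p in tuples A V | ~~ good_tuple pos pv p]|.
elim: n pos pv sA sV => // n IH pos pv sA sV ltn.
case: (set_0Vmem [set p in tuples A V | hitting_tuple pos pv p]) => [->|[q]].
  by rewrite cards0.
rewrite inE => /andP[qAV hq].
case: (set_0Vmem [set p in tuples A V | ~~ good_tuple pos pv p]) => [no|[b]].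
  apply: card_hitting_generic => [p pAV|j|]; last 2 first.
  - exact: balanced_sum0.
  - exact: balanced_sum0.
  apply/negPn/negP => bad; have : p \in set0 by rewrite -no inE pAV.
  by rewrite inE.
rewrite inE => /andP[bAV bad].
move: (bAV); rewrite inE => /andP[b1A b2V].
pose dpos j := displace (pos j) (A j) (b.1 j) (pos j (q.1 j)).
pose dpv := displace pv V b.2 (pv q.2).
pose G := [seq p <- enum (tuples A V) | good_tuple pos pv p] ++ [:: b].
pose H := [seq p <- enum (tuples A V) | hitting_tuple pos pv p].
have [||e [eG eH]] := @perturbation pos dpos pv dpv G H.
- move=> p; rewrite mem_cat mem_filter mem_seq1 => /orP[/andP[gp _]|/eqP->].
    exists 0; move: gp; rewrite !good_dets; congr (_ != 0); congr (_ * _).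
      by apply: eq_det_basis => k; rewrite /at_ shift0.
    by apply: eq_bigr => j _; apply: eq_det_basis => k; rewrite /repl /at_ !shift0.
  (* At time 1 the bad tuple [b] occupies the positions of the hitting tuple [q], so its polynomial
     is not identically zero. *)
  exists 1; move: (hitting_good hq); rewrite !good_dets.
  have E1 j : shift (pos j) (dpos j) 1 (b.1 j) = pos j (q.1 j).
    by rewrite /shift /dpos /displace eqxx scale1r addrC subrK.
  have E2 : shift pv dpv 1 b.2 = pv q.2.
    by rewrite /shift /dpv /displace eqxx scale1r addrC subrK.
  congr (_ != 0); congr (_ * _).
    by apply: eq_det_basis => k; rewrite /at_ E1.
  by apply: eq_bigr => j _; apply: eq_det_basis => k; rewrite /repl /at_ E1 E2.
- by move=> p; rewrite mem_filter => /andP[].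
pose pos' j := shift (pos j) (dpos j) e; pose pv' := shift pv dpv e.
apply: (@leq_trans #|[set p in tuples A V | hitting_tuple pos' pv' p]|).
  apply: subset_leq_card; apply/subsetP => p; rewrite !inE => /andP[pAV hp].
  by rewrite pAV eH // mem_filter hp mem_enum inE.
apply: IH.
- move=> j; rewrite big_split /= sA add0r -scaler_sumr sum_displace ?scaler0 //.
  exact: (familyP b1A).
- by rewrite big_split /= sV add0r -scaler_sumr sum_displace ?scaler0.
rewrite -ltnS; apply: leq_trans ltn; rewrite ltnS; apply: proper_card.
apply/properP; split; last first.
  by exists b; rewrite inE bAV //= negbK eG // mem_cat inE eqxx orbT.
apply/subsetP => p; rewrite !inE => /andP[pAV bp]; rewrite pAV /=.
by apply: contra bp => gp; apply: eG; rewrite mem_cat mem_filter gp mem_enum inE pAV.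
Qed.

End Perturbation.

From mathcomp Require Import finmap all_classical all_reals all_analysis.
Import numFieldNormedType.Exports.

(** * Convex combinations and positive weights on centered classes *)

Section ConvexGeometryFacts.
Variables (R : realType) (d : nat).
Implicit Types (B S : {fset 'rV[R]_d}) (x y z : 'rV[R]_d).

Lemma convex_setP (M : set 'rV[R]_d) : convex_set M <->
  forall x y (l : R), 0 <= l <= 1 -> M x -> M y -> M (l *: x + (1 - l) *: y).
Proof.
split=> [cM x y l l01 Mx My|H x y l Mx My].
  have /andP[l0 l1] := l01.
  have := cM x y (Itv01 l0 l1); rewrite !inE => /(_ Mx My).
  by rewrite /conv /=.
move: Mx My; rewrite !inE => Mx My.
apply: (H x y l%:num) => //; by apply/andP; split.
Qed.

Lemma convex_hull_sum B z : convex_hull [set` B]%classic z ->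
  exists l : 'rV[R]_d -> R, [/\ forall x, 0 <= l x,
     \sum_(x <- B) l x = 1 & \sum_(x <- B) l x *: x = z].
Proof.
move: z; apply: smallest_sub.
  apply/convex_setP => x y a /andP[a0 a1] [l [l0 l1 <-]] [k [k0 k1 <-]].
  exists (fun z => a * l z + (1 - a) * k z); split.
  - by move=> z; rewrite addr_ge0 // mulr_ge0 // subr_ge0.
  - by rewrite big_split /= -!mulr_sumr l1 k1 !mulr1 addrC subrK.
  - rewrite !scaler_sumr -big_split; apply: eq_bigr => z _.
    by rewrite scalerDl !scalerA.
move=> x /= xB; exists (fun z => (z == x)%:R); split => //.
  by rewrite (bigD1_seq x) ?fset_uniq //= eqxx big1 ?addr0 // => z /negPf ->.
rewrite (bigD1_seq x) ?fset_uniq //= eqxx scale1r big1 ?addr0 // => z /negPf ->.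
by rewrite scale0r.
Qed.

Lemma convex_set_sum (M : set 'rV[R]_d) (s : seq 'rV[R]_d) (l : 'rV[R]_d -> R) :
  convex_set M -> (forall x, x \in s -> M x) -> (forall x, x \in s -> 0 <= l x) ->
  \sum_(x <- s) l x = 1 -> M (\sum_(x <- s) l x *: x).
Proof.
move=> /convex_setP cM; elim: s l => [|x s IH] l sM l0.
  by rewrite big_nil => /esym/eqP; rewrite oner_eq0.
have sM' y : y \in s -> M y by move=> ys; apply: sM; rewrite inE ys orbT.
have l0' y : y \in s -> 0 <= l y by move=> ys; apply: l0; rewrite inE ys orbT.
have lx0 : 0 <= l x by rewrite l0 ?mem_head.
rewrite !big_cons => E; have rE : \sum_(y <- s) l y = 1 - l x by lra.
have r0 : 0 <= \sum_(y <- s) l y by rewrite big_seq sumr_ge0.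
case: (eqVneq (l x) 1) => [lx1|lx1].
  have l0s y : y \in s -> l y = 0.
    move=> ys; move: rE; rewrite lx1 subrr => /eqP.
    by rewrite big_seq psumr_eq0 // => /allP/(_ y ys); rewrite ys => /eqP.
  rewrite big_seq big1 ?addr0 => [|y /l0s ->]; last by rewrite scale0r.
  by rewrite lx1 scale1r; apply: sM; rewrite mem_head.
have k0 : 1 - l x != 0 by rewrite subr_eq0 eq_sym.
have -> : \sum_(y <- s) l y *: y = (1 - l x) *: \sum_(y <- s) (l y / (1 - l x)) *: y.
  by rewrite scaler_sumr; apply: eq_bigr => y _; rewrite scalerA mulrC divfK.
apply: cM; [by apply/andP; split=> //; lra | by apply: sM; rewrite mem_head|].
apply: (IH (fun y => l y / (1 - l x))) => // [y ys|].
  by rewrite divr_ge0 ?l0' -?rE.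
by rewrite -mulr_suml rE divff.
Qed.

Lemma convex_hull_of_sum B (l : 'rV[R]_d -> R) :
  (forall x, x \in B -> 0 <= l x) -> \sum_(x <- B) l x = 1 ->
  convex_hull [set` B]%classic (\sum_(x <- B) l x *: x).
Proof. by move=> l0 l1 M [cM BM]; apply: convex_set_sum. Qed.

(** An affine set through 0 is a linear subspace: [x + y] is the midpoint of [2 *: x] and
    [2 *: y]. *)
Lemma affine_set_scale_sum (M : set 'rV[R]_d) B (a : R) :
  affine_set M -> M 0 -> (forall x, x \in B -> M x) -> M (a *: \sum_(x <- B) x).
Proof.
move=> aM M0 BM.
have sM b x : M x -> M (b *: x).
  by move=> Mx; have := aM x 0 b Mx M0; rewrite scaler0 addr0.
apply: (sM a); rewrite big_seq; elim/big_ind: _ => // x y Mx My.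
have := aM _ _ (1 / 2) (sM 2 _ Mx) (sM 2 _ My).
have -> : 1 - 1 / 2 = 1 / 2 :> R by lra.
by rewrite !scalerA mul1r mulVf ?pnatr_eq0 // !scale1r.
Qed.

(** With [s] the sum of all points, a small negative multiple of [s] is still in the hull. Moving it
    to the other side of the equation adds a positive constant to each of its nonnegative
    weights. *)
Lemma centered_weights B : relative_interior (convex_hull [set` B]%classic) 0 ->
  exists2 w : 'rV[R]_d -> R, (forall x, 0 < w x) & \sum_(x <- B) w x *: x = 0.
Proof.
move=> [h0]; rewrite /within /= => near0.
pose s := \sum_(x <- B) x.
have cv : ((- e) *: s @[e --> (0 : R)] --> (0 : 'rV[R]_d))%classic.
  have -> : (0 : 'rV[R]_d) = (- 0) *: s by rewrite oppr0 scale0r.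
  by apply: cvgZr_tmp; apply: cvgN.
have := cv _ near0; rewrite /= => /nbhs_ballP[e /= e0 He].
have [||l [l0 _ ls]] := convex_hull_sum (He (e / 2) _ _).
- by rewrite /ball /= sub0r normrN gtr0_norm; lra.
- move=> M [aM hM]; apply: affine_set_scale_sum => //; first exact: hM.
  by move=> x xB; apply: hM => N [_]; apply.
exists (fun x => l x + e / 2); first by move=> x; have := l0 x; lra.
under eq_bigr => x _ do rewrite scalerDl.
by rewrite big_split /= ls -scaler_sumr -/s scaleNr addNr.
Qed.

Lemma fset_mem_sum (T : choiceType) (K B : {fset T}) (Q : Type) (idx : Q)
  (op : Monoid.com_law idx) (F : T -> Q) : (B `<=` K)%fset ->
  \big[op/idx]_(x : K | val x \in B) F (val x) = \big[op/idx]_(x <- B) F x.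
Proof.
move=> BK; rewrite -(big_seq_fsetE op K (mem B) F) -big_filter.
apply: perm_big; apply: uniq_perm; rewrite ?filter_uniq ?fset_uniq // => x.
rewrite mem_filter; apply: andb_idr; exact: (fsubsetP BK).
Qed.

End ConvexGeometryFacts.

(** * Affine independence and bases *)

Section AffineDimension.
Variables (R : realType) (d : nat).
Implicit Types (B S : {fset 'rV[R]_d}) (x y z : 'rV[R]_d).

Lemma span_differences S y : y \in S ->
  (<<[seq x - z | x <- enum_fset S, z <- enum_fset S]>> =
   <<[seq x - y | x <- enum_fset (S `\ y)%fset]>>)%VS.
Proof.
move=> yS; apply: subv_anti; apply/andP; split; apply/span_subvP => v.
  have H x : x \in S -> x - y \in <<[seq x - y | x <- enum_fset (S `\ y)%fset]>>%VS.
    move=> xS; case: (eqVneq x y) => [->|xy]; first by rewrite subrr mem0v.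
    by apply/memv_span/map_f; rewrite !inE xy.
  case/allpairsP => -[x z] /= [xS zS ->].
  have -> : x - z = (x - y) - (z - y) by rewrite opprB addrA subrK.
  by rewrite rpredB // H.
case/mapP => x; rewrite !inE => /andP[_ xS] ->.
by apply: memv_span; apply: allpairs_f.
Qed.

(** Deleting a point removes at most the direction [x - y] from the span of differences, so the
    dimension drops by at most one. *)
Lemma affine_dim_del S x : x \in S -> affine_dim S = #|` S|%:Z - 1 ->
  affine_dim (S `\ x)%fset = #|` (S `\ x)%fset|%:Z - 1.
Proof.
move=> xS; have S0 : S != fset0 by apply: contraTneq xS => ->; rewrite inE.
rewrite /affine_dim (negPf S0) (cardfsD1 x S) xS add1n => /eqP.
rewrite intS addrC addKr eqz_nat => /eqP dS.
case: eqP => [->|/eqP S'0]; first by rewrite cardfs0.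
have [y yS'] := fset0Pn _ S'0.
have [yx yS] : y != x /\ y \in S by move: yS'; rewrite !inE => /andP.
rewrite (span_differences yS'); rewrite (span_differences yS) in dS.
set S' := (S `\ x)%fset in dS yS' *.
have cS' : (#|` S'| = #|` (S' `\ y)%fset|.+1)%N by rewrite (cardfsD1 y) yS'.
rewrite cS' intS addrC addKr; congr (_%:Z); apply/eqP; rewrite eqn_leq; apply/andP; split.
  by rewrite (leq_trans (dim_span _)) // size_map.
rewrite -ltnS -cS' -dS.
apply: (@leq_trans (\dim (<<[seq x0 - y | x0 <- enum_fset (S' `\ y)%fset]>> + <[x - y]>)%VS)).
  apply: dimvS; apply/span_subvP => v /mapP[z]; rewrite !inE => /andP[zy zS] ->.
  case: (eqVneq z x) => [->|zx]; first exact: (subvP (addvSr _ _) _ (memv_line _)).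
  apply: (subvP (addvSl _ _)); apply/memv_span/map_f.
  by rewrite !inE zy zx.
by rewrite (leq_trans (dimv_add_leqif _ _)) // dim_vline; case: (_ != _); rewrite ?addn1 ?addn0.
Qed.

(** Solving the relation for [t ord0] gives negative coordinates. A linear form that kills all [m j]
    then kills every [t i], hence all differences of points of [S]; these span the space, so the
    form is 0. *)
Lemma basis_of_simplex S (t : 'I_d.+1 -> 'rV[R]_d) (l w : 'I_d.+1 -> R) :
  (forall x, x \in S -> exists i, x = t i) -> affine_dim S = d%:Z ->
  (forall i, 0 < l i) -> \sum_i l i *: t i = 0 -> (forall i, 0 < w i) ->
  let m := fun j : 'I_d => w (lift ord0 j) *: t (lift ord0 j) in
  rows_mx m \in unitmx /\ forall j, coord m j (w ord0 *: t ord0) < 0.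
Proof.
move=> St + l0 lt w0 m; rewrite /affine_dim; case: eqP => [_ hd|_ [dS]].
  by have : (0 : int) <= -1 by rewrite hd.
have t0E : w ord0 *: t ord0 =
    \sum_j (- (w ord0 * l (lift ord0 j) / (l ord0 * w (lift ord0 j)))) *: m j.
  have /eqP := lt; rewrite big_ord_recl addr_eq0 => /eqP e.
  have -> : t ord0 = (l ord0)^-1 *: (l ord0 *: t ord0).
    by rewrite scalerA mulVf ?scale1r // gt_eqF.
  rewrite e scalerN scaler_sumr scalerN scaler_sumr -sumrN.
  apply: eq_bigr => j _; rewrite /m !scalerA -scaleNr; congr (_ *: _).
  by field; rewrite !gt_eqF.
have mU : rows_mx m \in unitmx.
  rewrite -unitmx_tr -row_free_unit; apply: inj_row_free => v vm.
  have mv j : m j *m v^T = 0.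
    have := congr1 (fun N : 'rV[R]_d => row j N^T) vm.
    by rewrite /= trmx_mul trmxK row_mul rowK trmx0 row0.
  have tv i : t i *m v^T = 0.
    have wt : w i *: t i *m v^T = 0.
      case: (unliftP ord0 i) => [j ->|->]; first exact: mv.
      rewrite t0E mulmx_suml; apply: big1 => j _.
      by rewrite -scalemxAl mv scaler0.
    by move/eqP: wt; rewrite -scalemxAl scaler_eq0 gt_eqF // => /eqP.
  pose g := linfun (mulmxr (v^T) : 'rV[R]_d -> 'M[R]_1).
  have full : <<[seq x - y | x <- enum_fset S, y <- enum_fset S]>>%VS = fullv.
    apply/eqP; rewrite eqEdim subvf dS dimvf /= dim_matrix.
    by rewrite -[X in (X <= _)%N]/(1 * d)%N mul1n.
  have ker z : z *m v^T = 0.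
    have : z \in lker g.
      apply: (subvP _ z (memvf z)); rewrite -full; apply/span_subvP => y.
      case/allpairsP => -[a b] /= [/St[i ->] /St[j ->] ->].
      by rewrite memv_ker lfunE /= mulmxBl !tv subrr.
    by rewrite memv_ker lfunE /= => /eqP.
  apply/rowP => k; have := congr1 (fun N : 'rV[R]_1 => N 0 0) (ker (delta_mx 0 k)).
  by rewrite /= -rowE !mxE.
split=> // j; rewrite t0E coord_uniq // oppr_lt0.
by rewrite divr_gt0 // mulr_gt0.
Qed.

End AffineDimension.

(** * From hitting simplices to rainbow tuples *)

Section Translation.
Variables (R : realType) (d : nat) (C : 'I_d.+1 -> {fset 'rV[R]_d}).

(** Choosing a color for each point is injective by colorfulness, hence bijective by cardinality. A
    zero coefficient would leave 0 in the hull of a facet of dimension [d - 1], which relative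
    general position excludes. *)
Lemma tuple_of_hitting S : relative_general_position C -> hitting C S ->
  exists (t : 'I_d.+1 -> 'rV[R]_d) (l : 'I_d.+1 -> R),
    [/\ forall i, t i \in C i, forall x, x \in S <-> exists i, x = t i,
        forall i, 0 < l i & \sum_i l i *: t i = 0].
Proof.
move=> gp [[Spts Scol] Sdim cardS hull].
have cS : (#|` S| = d.+1)%N.
  by move: cardS => /eqP; rewrite subr_eq -PoszD eqz_nat addn1 => /eqP.
have /choice[col colP] : forall x : S, exists i, val x \in C i.
  move=> x.
  have /(fsubsetP Spts)/bigfcupP[i _ xi] := valP x; by exists i.
have col_inj : injective col.
  move=> x y xy; apply: val_inj.
  apply/eqP; apply: contraTT (Scol (col x)) => nxy; rewrite -ltnNge.
  apply: (@leq_trans #|` [fset val x; val y]%fset|); first by rewrite cardfs2 nxy.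
  apply: fsubset_leq_card; apply/fsubsetP => z; rewrite !inE => /orP[] /eqP ->.
    by rewrite (fsvalP x) colP.
  by rewrite (fsvalP y) xy colP.
have card_le : (#|'I_d.+1| <= #|{: S}|)%N by rewrite card_ord -cardfE cS.
have [inv colK invK] := inj_card_bij col_inj card_le.
have [m [m0 m1 msum]] := convex_hull_sum hull.
exists (fun i => val (inv i)), (fun i => m (val (inv i))).
have reind (F : 'rV[R]_d -> 'rV[R]_d) : \sum_i F (val (inv i)) = \sum_(x <- S) F x.
  rewrite (big_seq_fsetE _ S xpredT F) /= (reindex inv) //.
  by exists col => i _; rewrite ?colK ?invK.
split.
- by move=> i; have := colP (inv i); rewrite invK.
- move=> x; split=> [xS|[i ->]]; last exact: valP.
  by exists (col [` xS]%fset); rewrite colK.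
- move=> i; rewrite lt_def m0 andbT; apply/eqP => mi.
  set y := val (inv i) in mi; have yS : y \in S by exact: valP.
  have S'S : (S `\ y `<=` S)%fset := fsubD1set S y.
  apply: (gp (S `\ y)%fset).
  + split; first exact: fsubset_trans Spts.
    move=> j; apply: leq_trans (Scol j); apply: fsubset_leq_card.
    exact: fsetSI.
  + rewrite affine_dim_del ?Sdim // (cardfsD1 y S) yS add1n in cS *.
    by case: cS => ->.
  have E (V : zmodType) (F : 'rV[R]_d -> V) : F y = 0 ->
      \sum_(x <- (S `\ y)%fset) F x = \sum_(x <- S) F x.
    by move=> Fy; rewrite [RHS](big_fsetD1 y) //= Fy add0r.
  rewrite -msum -(E _ (fun x => m x *: x)); last by rewrite mi scale0r.
  by apply: convex_hull_of_sum => [x _|]; rewrite ?E.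
- by rewrite (reind (fun x => m x *: x)).
Qed.

End Translation.

Theorem theorem1p3 (R : realType) (d : nat) (C : 'I_d.+1 -> {fset 'rV[R]_d})
    (hcentered : centered C) (hgp : relative_general_position C)
    (hcard : forall i : 'I_d.+1, (2 <= #|` C i|)%N) :
  (csd C <= 1 + \prod_(i < d.+1) (#|` C i| - 1))%N.
Proof.
have Cpts i : (C i `<=` points C)%fset by apply: bigfcup_sup; rewrite ?mem_index_enum.
have /choice[W HW] : forall i, exists w : 'rV[R]_d -> R,
    (forall x, 0 < w x) /\ \sum_(x <- C i) w x *: x = 0.
  by move=> i; have [w w0 ws] := centered_weights (hcentered i); exists w.
(* All colors share the finite type of points. The classes may overlap, so the scaling in [pt]
   depends on the color and not just on the point. *)
pose cls i : {set points C} := [set x | val x \in C i]%SET.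
pose A (j : 'I_d) := cls (lift ord0 j); pose V := cls ord0.
pose pt i (x : points C) : 'rV[R]_d := W i (val x) *: val x.
pose pos (j : 'I_d) := pt (lift ord0 j); pose pv := pt ord0.
have sum0 i : \sum_(x in cls i) pt i x = 0.
  rewrite -[RHS](HW i).2 (eq_bigl (fun x : points C => val x \in C i)) => [|x].
    exact: (fset_mem_sum +%R (fun x => W i x *: x) (Cpts i)).
  by rewrite inE.
have card_cls i : #|cls i| = #|` C i|.
  rewrite -sum1_card -[RHS]sum1_size (eq_bigl (fun x : points C => val x \in C i)) => [|x].
    exact: (fset_mem_sum addn (fun=> 1%N) (Cpts i)).
  by rewrite inE.
have cls2 i : (2 <= #|cls i|)%N by rewrite card_cls.
have := @card_hitting R d (points C) pos A pv V (fun j => sum0 _) (sum0 _)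
  (fun j => cls2 _) (cls2 _).
have -> : (1 + (#|V| - 1) * \prod_j (#|A j| - 1) = 1 + \prod_(i < d.+1) (#|` C i| - 1))%N.
  rewrite big_ord_recl card_cls; congr (_ + _ * _)%N.
  by apply: eq_bigr => j _; rewrite card_cls.
apply: leq_trans.
(* Every hitting simplex is the image under [F] of a hitting tuple, so there are at most as many
   simplices as tuples. *)
pose F (p : {ffun 'I_d -> points C} * points C) : {fset 'rV[R]_d} :=
  (val p.2 |` [fset val (p.1 j) | j : 'I_d])%fset.
rewrite cardE -(size_map F); apply: uniq_leq_size; first exact: fset_uniq.
move=> S; rewrite !inE => /andP[_ /asboolP hS].
have [t [l [tC St l0 lt]]] := tuple_of_hitting hgp hS.
have tP i : t i \in points C by apply: (fsubsetP (Cpts i)).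
pose x i : points C := [` tP i]%fset.
pose p := ([ffun j : 'I_d => x (lift ord0 j)], x ord0).
have dS : affine_dim S = d%:Z by case: hS => _ -> ->.
have [mU mlt] := basis_of_simplex (fun y => (St y).1) dS l0 lt (fun i => (HW i).1 (t i)).
apply/mapP; exists p.
  rewrite mem_enum !inE; apply/andP; split.
    apply/andP; split; last exact: tC.
    by apply/familyP => j; rewrite ffunE inE /=; apply: tC.
  have E : at_ pos p.1 = fun j => W (lift ord0 j) (t (lift ord0 j)) *: t (lift ord0 j).
    by apply/funext => j; rewrite /at_ /pos /pt ffunE.
  by rewrite /hitting_tuple E mU; apply/forall_inP => j _; rewrite E; apply: mlt.
apply/fsetP => y; rewrite !inE; apply/idP/orP => [/St[i ->]|].
  case: (unliftP ord0 i) => [j ->|->]; [right|by left].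
  by apply/imfsetP; exists j => //=; rewrite ffunE.
by move=> [/eqP ->|/imfsetP[j _ ->]] /=; apply/St;
  [exists ord0|exists (lift ord0 j); rewrite ffunE].
Qed.
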